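(* Let $n,k$ be positive integers such that $n\ge k+4$ and $k\equiv 0 \pmod 3$. If $G\in\mathcal{P}(n,k)$, then $$m(G)\le \begin{cases} 3^{(n-k)/3}+\frac13(n-k)+1, & \text{if } n\equiv 0 \pmod 3;\\ 3^{(n-k-1)/3}+1, & \text{if } n\equiv 1 \pmod 3;\\ 3^{(n-k-2)/3}, & \text{if } n\equiv 2 \pmod 3;\end{cases}$$ with equality if and only if $$G\in \begin{cases}\mathcal{G}_1, & \text{if } n\equiv 0 \pmod 3;\\ \mathcal{G}_2, & \text{if } n\equiv 1 \pmod 3;\\ \bigcup_{i=3}^{7}\mathcal{G}_i, & \text{if } n\equiv 2 \pmod 3.\end{cases}$$
   Context: All graphs are finite, simple and undirected. A dissociation set of a graph $G$ is a subset of $V(G)$ inducing a subgraph of maximum degree at most $1$; a maximum dissociation set is one of maximum cardinality; $m(G)$ is the number of maximum dissociation sets of $G$. A unicyclic graph is a connected graph with exactly one cycle. A potted graph is a unicyclic graph whose cycle contains a unique vertex of degree larger than $2$. $\mathcal{P}(n,k)$ is the set of potted graphs of order $n$ whose cycle has order $k$. $P_j$ and $C_j$ are the path and cycle of order $j$. For vertex-disjoint trees $T_1,\dots,T_r$, $G_w(T_1,\dots,T_r)$ denotes a graph obtained from $T_1\cup\dots\cup T_r$ by choosing one leaf from each $T_i$ and identifying these $r$ leaves into a single vertex $w$. $C_k+_eG_w(T_1,\dots,T_r)$ is obtained from the disjoint union of $C_k$ and $G_w(T_1,\dots,T_r)$ by adding an edge between $w$ and a vertex of $C_k$; $C_k\odot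 G_w(T_1,\dots,T_r)$ is obtained by identifying $w$ with a vertex of $C_k$. Families of trees with distinguished vertex $w$ (below $l\ge1$ and each $T_i$ is $P_4$ or $K_{1,3}$, independently): $\mathcal{T}_1=\{P_3,\ G_w(P_3,P_4,\dots,P_4)\}$ (one $P_3$ and one or more copies of $P_4$; for the tree $P_3$ itself, $w$ is an end vertex); $\mathcal{T}_2=\{G_w(P_2,P_3),\ G_w(P_2,P_3,T_1,\dots,T_l)\}$; $\mathcal{T}_3=\{G_w(P_3,P_3),\ G_w(P_3,P_3,T_1,\dots,T_l)\}$; $\mathcal{T}_4=\{G_w(P_2,P_2,P_3),\ G_w(P_2,P_2,P_3,T_1,\dots,T_l)\}$; $\mathcal{T}_5=\{G_w(P_2,P_2,P_2,P_2),\ G_w(P_2,P_2,P_2,P_2,T_1,\dots,T_l)\}$. Families of potted graphs: $\mathcal{G}_j=\{C_k+_eT: T\in\mathcal{T}_j\}$ for $j=1,\dots,5$ (the edge is attached at $w$); $\mathcal{G}_6=\{C_k\odot G_w(P_3,T_1,\dots,T_l)\}$; $\mathcal{G}_7=\{C_k\odot G_w(P_2,P_2,T_1,\dots,T_l)\}$. Membership is up to isomorphism. *)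

(* Defs.v *)
From mathcomp Require Import all_boot.

Set Implicit Arguments.
Unset Strict Implicit.
Unset Printing Implicit Defensive.

Record sgraph := SGraph {
  vertex :> finType;
  adj : rel vertex;
  adj_sym : symmetric adj;
  adj_irrefl : irreflexive adj }.

Record rooted_graph := RootedGraph {
  graph_of :> sgraph;
  root_vertex : graph_of }.

Definition iso (G H : sgraph) : Prop :=
  exists f : G -> H, bijective f /\ forall x y, adj (f x) (f y) = adj x y.

Section Basics.
Variable G : sgraph.

Definition degree (v : G) : nat := #|[set u | adj v u]|.

Definition max_degree : nat := \max_(v : G) degree v.

Definition is_leaf (v : G) : bool := degree v == 1.

Definition connected : Prop := forall x y : G, connect (@adj G) x y.

(* A cycle is listed as a cyclic sequence of vertices; two lists describe the
   same cycle (subgraph) iff they have the same edge set, since a list may be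
   rotated or reversed. *)
Definition is_cycle (c : seq G) : bool := (2 < size c) && ucycleb (@adj G) c.

Definition cycle_edges (c : seq G) : {set {set G}} :=
  [set [set x; next c x] | x in c].

Definition unicyclic : Prop :=
  connected /\
  exists2 c, is_cycle c & forall d, is_cycle d -> cycle_edges d = cycle_edges c.

Definition potted : Prop :=
  unicyclic /\ forall c, is_cycle c -> #|[set v in c | 2 < degree v]| = 1.

Definition potted_of (n k : nat) : Prop :=
  [/\ potted, #|G| = n & forall c, is_cycle c -> size c = k].

End Basics.

Section Induced.
Variables (G : sgraph) (S : {set G}).

Definition induced_adj : rel {x : G | x \in S} :=
  fun x y => adj (val x) (val y).

Lemma induced_sym : symmetric induced_adj.
Proof. by move=> x y; apply: adj_sym. Qed.

Lemma induced_irrefl : irreflexive induced_adj.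
Proof. by move=> x; apply: adj_irrefl. Qed.

Definition induced : sgraph := SGraph induced_sym induced_irrefl.

End Induced.

Section Dissociation.
Variable G : sgraph.

Definition dissociation (S : {set G}) : bool := max_degree (induced S) <= 1.

Definition max_dissociation (S : {set G}) : bool :=
  dissociation S && [forall S' : {set G}, dissociation S' ==> (#|S'| <= #|S|)].

Definition num_max_dissociation : nat :=
  #|[set S : {set G} | max_dissociation S]|.

End Dissociation.

Section PathGraph.
Variable j : nat.

Definition path_adj : rel 'I_j := fun x y => (x.+1 == y) || (y.+1 == x).

Lemma path_sym : symmetric path_adj.
Proof. by move=> x y; rewrite /path_adj orbC. Qed.

Lemma path_irrefl : irreflexive path_adj.
Proof. by move=> x; rewrite /path_adj orbb gtn_eqF. Qed.

Definition Path : sgraph := SGraph path_sym path_irrefl.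

End PathGraph.

Section CycleGraph.
Variable j : nat.

(* [ordS] is the successor modulo [j].  This is the cycle of order [j] when
   [2 < j]. *)
Definition cycle_adj : rel 'I_j :=
  fun x y => (x != y) && ((ordS x == y) || (ordS y == x)).

Lemma cycle_sym : symmetric cycle_adj.
Proof. by move=> x y; rewrite /cycle_adj eq_sym orbC. Qed.

Lemma cycle_irrefl : irreflexive cycle_adj.
Proof. by move=> x; rewrite /cycle_adj eqxx. Qed.

Definition Cycle : sgraph := SGraph cycle_sym cycle_irrefl.

End CycleGraph.

Section CompleteBipartite.
Variables p q : nat.

Definition bipartite_adj : rel ('I_p + 'I_q)%type := fun x y =>
  match x, y with
  | inl _, inr _ | inr _, inl _ => true
  | _, _ => false
  end.

Lemma bipartite_sym : symmetric bipartite_adj.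
Proof. by move=> [x|x] [y|y]. Qed.

Lemma bipartite_irrefl : irreflexive bipartite_adj.
Proof. by move=> [x|x]. Qed.

Definition complete_bipartite : sgraph :=
  SGraph bipartite_sym bipartite_irrefl.

End CompleteBipartite.

(* Disjoint union of [A] and [B] with one extra edge between the roots. *)
Section JoinByEdge.
Variables A B : rooted_graph.

Definition join_adj : rel (A + B)%type := fun x y =>
  match x, y with
  | inl a, inl a' => adj a a'
  | inr b, inr b' => adj b b'
  | inl a, inr b | inr b, inl a => (a == root_vertex A) && (b == root_vertex B)
  end.

Lemma join_sym : symmetric join_adj.
Proof. by move=> [a|b] [a'|b'] //=; apply: adj_sym. Qed.

Lemma join_irrefl : irreflexive join_adj.
Proof. by move=> [a|b]; apply: adj_irrefl. Qed.

Definition join_by_edge : sgraph := SGraph join_sym join_irrefl.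

End JoinByEdge.

(* Disjoint union of [A] and [B] with the two roots identified: the merged
   vertex is represented by [inl (root_vertex A)], and [root_vertex B] is
   dropped. *)
Section Identify.
Variables A B : rooted_graph.

Definition identify_adj : rel (A + {b : B | b != root_vertex B})%type := fun x y =>
  match x, y with
  | inl a, inl a' => adj a a'
  | inr b, inr b' => adj (val b) (val b')
  | inl a, inr b | inr b, inl a => (a == root_vertex A) && adj (root_vertex B) (val b)
  end.

Lemma identify_sym : symmetric identify_adj.
Proof. by move=> [a|b] [a'|b'] //=; apply: adj_sym. Qed.

Lemma identify_irrefl : irreflexive identify_adj.
Proof. by move=> [a|b]; apply: adj_irrefl. Qed.

Definition identify_graph : sgraph := SGraph identify_sym identify_irrefl.

Definition identify : rooted_graph := @RootedGraph identify_graph (inl (root_vertex A)).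

End Identify.

(* [Gw Ts R]: the graph [R], rooted at [w], is obtained by choosing one leaf
   in each graph of [Ts] and identifying all of these leaves into [w].  The
   recursion starts from the one-vertex graph. *)
Inductive Gw : seq sgraph -> rooted_graph -> Prop :=
| Gw_nil : Gw [::] (@RootedGraph (Path 1) ord0)
| Gw_cons (T : sgraph) (x : T) (Ts : seq sgraph) (R : rooted_graph) :
    is_leaf x -> Gw Ts R -> Gw (T :: Ts) (identify (RootedGraph x) R).

(* A list T_1, ..., T_l, each T_i being P_4 or K_{1,3}. *)
Definition branches (bs : seq bool) : seq sgraph :=
  [seq if b then Path 4 else complete_bipartite 1 3 | b <- bs].

(* In the five families below the number of copies of P_4, respectively of
   branches, may be 0; this accounts for the members listed separately, and
   [Gw [:: Path 3]] is P_3 rooted at an end vertex. *)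
Definition trees1 (R : rooted_graph) : Prop :=
  exists l, Gw (Path 3 :: nseq l (Path 4)) R.

Definition trees2 (R : rooted_graph) : Prop :=
  exists bs, Gw ([:: Path 2; Path 3] ++ branches bs) R.

Definition trees3 (R : rooted_graph) : Prop :=
  exists bs, Gw ([:: Path 3; Path 3] ++ branches bs) R.

Definition trees4 (R : rooted_graph) : Prop :=
  exists bs, Gw ([:: Path 2; Path 2; Path 3] ++ branches bs) R.

Definition trees5 (R : rooted_graph) : Prop :=
  exists bs, Gw ([:: Path 2; Path 2; Path 2; Path 2] ++ branches bs) R.

Definition trees6 (R : rooted_graph) : Prop :=
  exists2 bs, 0 < size bs & Gw ([:: Path 3] ++ branches bs) R.

Definition trees7 (R : rooted_graph) : Prop :=
  exists2 bs, 0 < size bs & Gw ([:: Path 2; Path 2] ++ branches bs) R.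

(* Graphs C_k +_e T, respectively C_k \odot T, up to isomorphism, for T in a
   family of rooted trees. *)
Definition cycle_plus (k : nat) (Ts : rooted_graph -> Prop) (G : sgraph) : Prop :=
  exists (v : Cycle k) (R : rooted_graph), Ts R /\
    iso G (join_by_edge (RootedGraph v) R).

Definition cycle_dot (k : nat) (Ts : rooted_graph -> Prop) (G : sgraph) : Prop :=
  exists (v : Cycle k) (R : rooted_graph), Ts R /\
    iso G (identify (RootedGraph v) R).

Definition family1 (k : nat) : sgraph -> Prop := cycle_plus k trees1.
Definition family2 (k : nat) : sgraph -> Prop := cycle_plus k trees2.
Definition family3 (k : nat) : sgraph -> Prop := cycle_plus k trees3.
Definition family4 (k : nat) : sgraph -> Prop := cycle_plus k trees4.
Definition family5 (k : nat) : sgraph -> Prop := cycle_plus k trees5.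
Definition family6 (k : nat) : sgraph -> Prop := cycle_dot k trees6.
Definition family7 (k : nat) : sgraph -> Prop := cycle_dot k trees7.

(* Main.v *)
Require Import Defs.
From mathcomp Require Import all_boot zify.

(** Let r be the branching vertex on the cycle, and T_1, ..., T_p the components
    of G minus the cycle, rooted at the neighbours of r.  As k is a multiple of 3,
    the maximum dissociation sets of the cycle are the complements of the three
    residue classes mod 3, and exactly one of them avoids r.  Comparing sizes,
      m(G) = prod m(T_i) + 2 prod m0(T_i),
    where m0 counts the maximum dissociation sets that avoid the root; so k only
    enters through n - k.  Both numbers follow from a recursion on rooted trees
    that keeps, for the sets missing the root, isolating it or matching it, the
    numbers of sets of the two relevant top sizes.  For a tree with 3 a + b vertices,
    b < 3, these numbers divided by 3^a lie in an explicit polytope depending on b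
    and on the kind of tree, and attaching a subtree maps these polytopes into each
    other.  The exceptions are the trees all of whose root branches have at most
    three vertices; they have closed formulas, and the extremal graphs are found
    among them. *)

Set Implicit Arguments.
Unset Strict Implicit.
Unset Printing Implicit Defensive.

(** * Weights of rooted trees *)

(** [Graft c t] gives the root of [t] one more child, the root of [c]. *)
Inductive rtree := Leaf | Graft of rtree & rtree.

Fixpoint tree_order t := if t is Graft c t' then tree_order c + tree_order t' else 1.

(** Let [d] be the largest size of a dissociation set missing the root.  The
    fields count the sets missing the root, isolating the root, and matching the
    root to a neighbour, of respective sizes
      [StA]: d, d + 1, d + 1;   [StB]: d, d, d + 1;   [StC]: d, d, d.
    In each case no set in one of the three classes is larger than indicated. *)
Inductive state :=
  | StA of nat & nat & nat
  | StB of nat & nat & nat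
  | StC of nat & nat & nat.

Definition weight s :=
  match s with
  | StA _ u w => u + w
  | StB _ _ w => w
  | StC p v y => p + v + y
  end.

(** Maximum sets missing the root exist only in [StC]: in the other two kinds, sets missing the root
    fall one short of the maximum. *)
Definition avoid s := if s is StC p _ _ then p else 0.

(** A set missing the root of [t] combines with any maximum set of [c]. One isolating the root needs
    the root of [c] absent. The root is matched either inside [t], with the root of [c] absent, or
    along the new edge, with both roots isolated on their own sides. Each case keeps only the
    products that reach the size recorded by the resulting state. *)
Definition step (c t : state) :=
  match c, t with
  | StA n u _, StA n' u' _ => StB (weight c * n') (n * u') (u * u')
  | StA n u _, StB n' v w => StC (weight c * n') 0 (n * w + u * v)
  | StA n u _, StC n' v _ => StC (weight c * n') 0 (u * v)
  | StB n v _, StA n' u' w' => StC (weight c * n') (n * u') (n * w' + v * u')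
  | StB n _ _, StB n' _ w => StC (weight c * n') 0 (n * w)
  | StB _ _ _, StC n' _ _ => StC (weight c * n') 0 0
  | StC p v _, StA n' u w => StA (weight c * n') (p * u) (p * w + v * u)
  | StC p _ _, StB n' v w => StB (weight c * n') (p * v) (p * w)
  | StC p v _, StC n' v' y' =>
      StC (weight c * n') (p * v') (p * y' + v * v')
  end.

(** The start state [b] describes what sits at the root, so that one recursion serves both a single
    vertex, whose state is [StA 1 1 0], and a cycle. *)
Fixpoint state_from (b : state) t :=
  if t is Graft c t' then step (state_from (StA 1 1 0) c) (state_from b t')
  else b.

Definition statet := state_from (StA 1 1 0).

Definition positive s :=
  match s with
  | StA n u _ => (0 < n) && (0 < u)
  | StB n v w => [&& 0 < n, 0 < v & 0 < w]
  | StC p _ _ => 0 < p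
  end.

(** Here [h = 3 ^ (n %/ 3)] and [r = n %% 3] for a tree with [n] vertices.  The
    constants are chosen so that these bounds reproduce themselves under [step];
    they fail for [n <= 3].  The bounds [strong] force strict inequality in the
    theorem, and may fail if all root branches have at most three vertices. *)
Definition crude h r s :=
  match s, r with
  | StA n u w, 0 => 9 * (u + w) <= h /\ 3 * (u + w + n + u) <= h
  | StA n u w, 1 => [/\ 3 * (u + w) <= 2 * h, n <= h, 3 * u <= h
                      & 3 * (u + w) + n + u <= 3 * h + 1]
  | StA n u w, _ => 3 * (u + w) <= h /\ 3 * n <= 2 * h
  | StB n v w, 0 => [/\ 9 * w <= h, 3 * (w + n) <= h, 3 * v <= h
                      & 3 * n + w + v <= h]
  | StB n v w, 1 => 9 * w <= h /\ 3 * (n + v + w) <= h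
  | StB n v w, _ => [/\ 3 * w <= h, n <= h, v <= h & 3 * (n + v) <= 5 * h]
  | StC p v y, 0 => [/\ 3 * (p + v + y) <= 2 * h, 3 * p <= h & 3 * v <= h]
  | StC p v y, 1 => 3 * (p + v + y) <= 2 * h /\ 3 * (p + v) <= h
  | StC p v y, _ => 3 * (p + v + y) <= h /\ 3 * (p + v) <= h
  end.

Definition strong h r s :=
  match s, r with
  | StA n u w, 1 => 3 * n <= 2 * h /\ 3 * (u + w) + n + u <= 3 * h
  | StB n v w, 2 => 3 * n + w + v <= 3 * h + 1
  | StC p v y, 0 => [/\ 3 * p < h, 3 * p + v <= h & 3 * p + v + y <= h + 1]
  | StC p v y, 1 => 3 * p < h /\ 3 * p + v + y <= h
  | StC p v y, 2 => 3 * p < h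
  | _, _ => True
  end.

Lemma step_positive s1 s2 : positive s1 -> positive s2 -> positive (step s1 s2).
Proof.
case: s1 => [n u w|n v w|p v y]; case: s2 => [n' u' w'|n' v' w'|p' v' y'] /=;
rewrite ?muln_gt0 ?addn_gt0; lia.
Qed.

(** The correction to the product of the two powers [3 ^ (n %/ 3)] when orders with remainders [r1]
    and [r2] are added. *)
Definition carry r1 r2 := if r1 + r2 < 3 then 1 else 3.

Ltac split_hyps :=
  intros; repeat match goal with
  | H : [/\ _, _, _ & _] |- _ => case: H; intros
  | H : [/\ _, _ & _] |- _ => case: H; intros
  | H : _ /\ _ |- _ => case: H; intros
  | H : is_true [&& _, _ & _] |- _ => case/and3P: H; intros
  | H : is_true (_ && _) |- _ => case/andP: H; intros
  end.

(** The counts produced by [step] are bilinear in the two states, so fixing the kinds and the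
    residues leaves finitely many polynomial inequalities. *)
Lemma step_crude h1 r1 h2 r2 s1 s2 : r1 < 3 -> r2 < 3 ->
  positive s1 -> positive s2 -> crude h1 r1 s1 -> crude h2 r2 s2 ->
  let h := h1 * h2 * carry r1 r2 in let r := (r1 + r2) %% 3 in
  crude h r (step s1 s2) /\ strong h r (step s1 s2).
Proof.
case: r1 => [|[|[|//]]] _; case: r2 => [|[|[|//]]] _;
case: s1 => [n u w|n v w|p v y]; case: s2 => [n' u' w'|n' v' w'|p' v' y'];
rewrite /carry /=; split_hyps; repeat split; nia.
Qed.

(** A piece codes what remains of P_2, P_3, P_4 or K_(1,3), rooted at the
    neighbour of the leaf [w], once [w] is deleted. *)
Definition piece := (bool * bool)%type.

Definition piece_tree (p : piece) : rtree :=
  match p with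
  | (false, false) => Leaf
  | (false, true) => Graft Leaf Leaf
  | (true, true) => Graft (Graft Leaf Leaf) Leaf
  | (true, false) => Graft Leaf (Graft Leaf Leaf)
  end.

(** The four codes exhaust the rooted trees on at most three vertices, so [None] means at least
    four. *)
Definition as_piece t : option piece :=
  match t with
  | Leaf => Some (false, false)
  | Graft Leaf Leaf => Some (false, true)
  | Graft (Graft Leaf Leaf) Leaf => Some (true, true)
  | Graft Leaf (Graft Leaf Leaf) => Some (true, false)
  | _ => None
  end.

Lemma as_pieceK t p : as_piece t = Some p -> t = piece_tree p.
Proof.
by case: t => [|[|[|? ?] [|? ?]] [|[|? ?] [|? ?]]] //= [<-].
Qed.

Definition of_pieces (ps : seq piece) : rtree := foldr (fun p =>
  Graft (piece_tree p)) Leaf ps.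

(** The numbers of branches at [w] that come from P_2, from P_3, from P_4 or K_(1,3), and from P_4
    alone. *)
Definition nleaf := count (pred1 (false, false) : pred piece).
Definition nedge := count (pred1 (false, true) : pred piece).
Definition nbranch := count (fun p : piece => p.1).
Definition nend := count (pred1 (true, true) : pred piece).

Lemma nend_le_nbranch ps : nend ps <= nbranch ps.
Proof. by apply: sub_count => -[[] []]. Qed.

Lemma tree_order_of_pieces ps : tree_order (of_pieces ps) =
  (nleaf ps + 2 * nedge ps + 3 * nbranch ps).+1.
Proof.
rewrite /nleaf /nedge /nbranch.
by elim: ps => //= -[[] []] ps -> /=; lia.
Qed.

(** Any two vertices of a three-vertex piece form a maximum set of it: three choices when the common
    root is absent, but only one missing the root of the piece. A set isolating the root of the
    piece reaches this size only if that root is an end; such pieces are counted by [e]. *)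
Definition pieces_state (i j l e : nat) : state :=
  match i, j with
  | 0, 0 => StA (3 ^ l) 1 e
  | 1, 0 => StB (3 ^ l) 1 1
  | 0, 1 => StC (3 ^ l) 1 e.+1
  | 2, 0 => StC (3 ^ l) 0 2
  | 1, 1 => StC (3 ^ l) 0 1
  | _, _ => StC (3 ^ l) 0 0
  end.

Lemma statet_of_pieces ps :
  statet (of_pieces ps) = pieces_state (nleaf ps) (nedge ps) (nbranch ps) (nend ps).
Proof.
rewrite /nleaf /nedge /nbranch /nend /statet.
elim: ps => //= -[a b] ps ->.
rewrite -/(nleaf ps) -/(nedge ps) -/(nbranch ps) -/(nend ps).
move: (nleaf ps) (nedge ps) (nbranch ps) (nend ps) => i j l e.
case: a b => [] [] /=; rewrite !add0n ?addn0 ?add1n;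
case: i => [|[|[|i]]]; case: j => [|[|[|j]]] //=; rewrite ?expnS; f_equal; lia.
Qed.

Lemma positive_statet t : positive (statet t).
Proof. by elim: t => //= c IHc t IHt; apply: step_positive. Qed.

Definition height n := 3 ^ (n %/ 3).

Lemma heightD n1 n2 :
  height (n1 + n2) = height n1 * height n2 * carry (n1 %% 3) (n2 %% 3).
Proof.
rewrite /height /carry; have [lt|ge] := ltnP (n1 %% 3 + n2 %% 3) 3.
  by rewrite muln1 -expnD; congr (3 ^ _); lia.
by rewrite mulnC -expnD -expnS; congr (3 ^ _); lia.
Qed.

Lemma height_gt0 n : 0 < height n. Proof. by rewrite expn_gt0. Qed.

Definition crude_at t := crude (height (tree_order t)) (tree_order t %% 3) (statet t).
Definition strong_at t := strong (height (tree_order t)) (tree_order t %% 3) (statet t).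

(** Absorbs the count [e], which is at most [l], into a power of 3. *)
Lemma exp3_lower l : 2 * l < 3 ^ l.
Proof. by elim: l => // l IH; rewrite expnS; lia. Qed.

Lemma of_pieces_crude ps : as_piece (of_pieces ps) = None -> crude_at (of_pieces ps).
Proof.
move=> nps; rewrite /crude_at statet_of_pieces tree_order_of_pieces.
have := nend_le_nbranch ps; have := exp3_lower (nbranch ps).
(* Having at least four vertices, expressed through the counts. *)
have: [|| 0 < nbranch ps, 2 < nleaf ps | (0 < nedge ps) && (1 < nleaf ps + nedge ps)].
  case: ps nps => [|[[] []] [|[[] []] [|[[] []] ps]]] //;
    rewrite /nleaf /nedge /nbranch /=; lia.
move: (nleaf ps) (nedge ps) (nbranch ps) (nend ps) => i j l e cnd lt3 le_el.
have -> : height (i + 2 * j + 3 * l).+1 = height (i + 2 * j).+1 * 3 ^ l.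
  rewrite -(mul1n (3 * l)) mulnA /height -expnD; congr (3 ^ _); lia.
have -> : (i + 2 * j + 3 * l).+1 %% 3 = (i + 2 * j).+1 %% 3 by lia.
have big : 2 < i + j -> 2 < height (i + 2 * j).+1.
  by move=> ?; rewrite /height (@leq_exp2l 3 1) //; lia.
have pos := height_gt0 (i + 2 * j).+1.
case: (leqP (i + j) 2) => [le2|/[dup]/big].
  case: i j {big pos} le2 cnd => [|[|[|i]]] [|[|[|j]]] //= _; rewrite ?addn0 /height /=;
  rewrite ?expn0 ?expn1 => ?; try lia; repeat split; try lia.
(* With three or more branches of at most two vertices, sets containing the root are too small to
   count, while [height] has a spare factor 3. *)
move=> {}big gt2.
have -> : pieces_state i j l e = StC (3 ^ l) 0 0.
  by case: i j gt2 {cnd big pos} => [|[|[|i]]] [|[|[|j]]].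
move: (height _) pos big => h pos big.
case: (_ %% 3) => [|[|r]] /=; repeat split; nia.
Qed.

(** Pieces violate [crude], so their four explicit states are inserted. The weight of a piece equals
    its [height]; a piece thus causes no loss of its own, and strictness has to come from [strong]
    for the rest. *)
Lemma step_piece_crude p h r s : r < 3 -> positive s -> crude h r s -> strong h r s ->
  let n := tree_order (piece_tree p) in let s' := step (statet (piece_tree p)) s in
  let h' := height n * h * carry (n %% 3) r in let r' := (n %% 3 + r) %% 3 in
  crude h' r' s' /\ strong h' r' s'.
Proof.
case: r => [|[|[|//]]] _; case: p => [[] []]; case: s => [n u w|n v w|p v y];
rewrite /carry /height /statet /= ?expn0 ?expn1; split_hyps; repeat split; nia.
Qed.

(** Now the piece receives the branch, and the loss in the [crude] bound of the branch already
    yields [strong]. *)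
Lemma crude_step_piece p h r s : r < 3 -> positive s -> crude h r s ->
  let n := tree_order (piece_tree p) in let s' := step s (statet (piece_tree p)) in
  let h' := h * height n * carry r (n %% 3) in let r' := (r + n %% 3) %% 3 in
  crude h' r' s' /\ strong h' r' s'.
Proof.
case: r => [|[|[|//]]] _; case: p => [[] []]; case: s => [n u w|n v w|p v y];
rewrite /carry /height /statet /= ?expn0 ?expn1; split_hyps; repeat split; nia.
Qed.

(** A root branch that is a piece preserves whichever alternative holds. A larger branch is itself
    [crude], and what it is grafted on is a piece or [crude], so it forces the bounds. *)
Lemma statet_bound t : (exists ps, t = of_pieces ps) \/ crude_at t /\ strong_at t.
Proof.
elim: t => [|c IHc t IHt]; first by left; exists [::].
have le3 n : n %% 3 < 3 by rewrite ltn_pmod.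
case cE: (as_piece c) => [p|].
  rewrite (as_pieceK cE); case: IHt => [[ps ->]|[crt stt]]; first by left;
    exists (p :: ps).
  right; rewrite /crude_at /strong_at /= heightD -modnDm.
  by apply: step_piece_crude => //; apply: positive_statet.
have {IHc} crc : crude_at c by case: IHc => [[ps cps]|[]//]; rewrite cps in cE *;
  apply: of_pieces_crude.
right; rewrite /crude_at /strong_at /= heightD -modnDm.
case tE: (as_piece t) => [p|].
  by rewrite (as_pieceK tE); apply: crude_step_piece => //; apply: positive_statet.
apply: step_crude => //; try exact: positive_statet.
by case: IHt => [[ps tps]|[]//]; rewrite tps in tE *; apply: of_pieces_crude.
Qed.

Lemma not_piece_crude c : as_piece c = None -> crude_at c.
Proof.
by move=> cE; case: (statet_bound c) => [[ps cps]|[]//]; rewrite cps in cE *;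
  apply: of_pieces_crude.
Qed.

(** [StC 1 0 2] is the state of a cycle whose order is a multiple of 3. *)
Definition potted_state := state_from (StC 1 0 2).

Fixpoint total_weight t := if t is Graft c t' then weight (statet c) * total_weight
  t' else 1.
Fixpoint total_avoid t := if t is Graft c t' then avoid (statet c) * total_avoid t'
  else 2.

(** No maximum set of the cycle isolates the branching vertex, so at top size that vertex is never
    matched into a component. It is either absent, leaving the components free, or matched on the
    cycle, with every component missing its root. *)
Lemma potted_stateE t : potted_state t = StC (total_weight t) 0 (total_avoid t).
Proof.
rewrite /potted_state; elim: t => //= c _ t ->; rewrite -/(statet c).
by case: (statet c) => *; rewrite /= ?muln0 ?addn0.
Qed.

Lemma total_weight_of_pieces ps : total_weight (of_pieces ps) = 3 ^ nbranch ps.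
Proof.
rewrite /nbranch; elim: ps => //= p ps ->.
by case: p => [[] []]; rewrite /= ?mul1n ?expnS.
Qed.

Lemma total_avoid_of_pieces ps :
  total_avoid (of_pieces ps) = if nleaf ps + nedge ps == 0 then 2 else 0.
Proof.
by rewrite /nleaf /nedge; elim: ps => //= p ps ->; case: p => [[] []];
  rewrite /= ?mul1n // addnS.
Qed.

Lemma not_piece_weight c : as_piece c = None ->
  3 * weight (statet c) <= 2 * height (tree_order c) /\
  3 * avoid (statet c) <= height (tree_order c).
Proof.
move/not_piece_crude; rewrite /crude_at; move: (height _) (_ %% 3) => h r.
by case: (statet c) r => [n u w|n v w|p v y] [|[|r]] /=; split_hyps; split; lia.
Qed.

Lemma piece_weight p :
  weight (statet (piece_tree p)) <= height (tree_order (piece_tree p)) /\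
  (avoid (statet (piece_tree p)) = 0 \/
   3 * avoid (statet (piece_tree p)) <= height (tree_order (piece_tree p))).
Proof. by case: p => [[] []]; split; rewrite //; [right|right|left|left]. Qed.

Lemma height_super n1 n2 : height n1 * height n2 <= height (n1 + n2).
Proof. by rewrite heightD leq_pmulr // /carry; case: ifP. Qed.

Lemma tree_order_gt0 t : 0 < tree_order t.
Proof. by elim: t => //= c IHc t IHt; rewrite addn_gt0 IHc. Qed.

(** The root of [t] stands for the vertex on the cycle and its branches for the components. A
    component with at least four vertices loses a factor 2/3 in [weight] and 1/3 in [avoid]; beside
    any other component this leaves at most 2/3 + 2/9 of [height]. *)
Variant forest_spec t : Prop :=
  | ForestSmall ps of t = of_pieces ps
  | ForestSingle c of t = Graft c Leaf & as_piece c = None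
  | ForestCrude of 3 * total_weight t <= 2 * height (tree_order t).-1
                 & 9 * total_avoid t <= 2 * height (tree_order t).-1.

Lemma forestP t : forest_spec t.
Proof.
elim: t => [|c _ t IH]; first exact: (@ForestSmall _ [::]).
have sup : height (tree_order c) * height (tree_order t).-1 <= height (tree_order
  (Graft c t)).-1.
  by rewrite (leq_trans (height_super _ _)) //= -subn1 addnBA ?tree_order_gt0 // subn1.
case cE: (as_piece c) => [p|].
  have {cE} cE := as_pieceK cE.
  case: (piece_weight p); rewrite -cE => w1 w2.
  case: IH sup => [ps ->|d -> /[dup] dN /not_piece_weight [m1 m2]|q y] sup.
  - by rewrite cE; apply: (@ForestSmall _ (p :: ps)).
  - rewrite /= addn1 /= in sup.
    by apply: ForestCrude => /=; rewrite addn1 /=; nia.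
  - by apply: ForestCrude => /=; rewrite /= in sup; nia.
have [m1 m2] := not_piece_weight cE.
case: IH sup => [ps ->|d -> /not_piece_weight [m1' m2']|q y] sup.
- case: ps sup => [|p ps] sup; first exact: ForestSingle cE.
  have pos : 0 < 3 ^ nbranch ps by rewrite expn_gt0.
  have hN : 3 ^ nbranch (p :: ps) <= height (tree_order (of_pieces (p :: ps))).-1.
    by rewrite tree_order_of_pieces /= leq_exp2l //; lia.
  have tE : total_weight (Graft c (of_pieces (p :: ps))) =
    weight (statet c) * 3 ^ nbranch (p :: ps).
    by rewrite -total_weight_of_pieces.
  have aE : total_avoid (Graft c (of_pieces (p :: ps))) =
      avoid (statet c) * total_avoid (of_pieces (p :: ps)) by [].
  move: sup hN; rewrite total_avoid_of_pieces in aE => sup hN.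
  apply: ForestCrude; rewrite ?tE ?aE; first nia.
  (* If only three-vertex pieces accompany [c], each allows a single choice missing its root while
     tripling [height]; one such piece suffices. *)
  case: ifP => [z|_]; last by rewrite muln0.
  have : 3 <= 3 ^ nbranch (p :: ps).
    by move: z; rewrite /nleaf /nedge /nbranch;
      case: p {sup hN tE aE} => [[] []] /= z; rewrite ?add1n ?expnS;
      have := expn_gt0 3 (count (fun p => p.1) ps); lia.
  nia.
- by rewrite /= addn1 /= in sup; apply: ForestCrude => /=; rewrite addn1 /=; nia.
- by rewrite /= in sup; apply: ForestCrude => /=; nia.
Qed.

(** The bound of the theorem for [N] vertices off the cycle; [N] and n have the same residue because
    3 divides k. *)
Definition max_weight N :=
  match N %% 3 with
  | 0 => 3 ^ (N %/ 3) + N %/ 3 + 1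
  | 1 => 3 ^ (N %/ 3) + 1
  | _ => 3 ^ (N %/ 3)
  end.

(** The case [r = 2] splits into the families 3, 4, 5 (cycle joined to [w] by an
    edge) and 6, 7 ([w] on the cycle). *)
Definition extremal r t : Prop :=
  match r with
  | 0 => exists2 ps, t = Graft (of_pieces ps) Leaf
          & [/\ nleaf ps = 0, nedge ps = 1 & nend ps = nbranch ps]
  | 1 => exists2 ps, t = Graft (of_pieces ps) Leaf & nleaf ps = 1 /\ nedge ps = 1
  | _ => (exists2 ps, t = Graft (of_pieces ps) Leaf
           & (nleaf ps, nedge ps) \in [:: (0, 2); (2, 1); (4, 0)])
         \/ (exists2 ps, t = of_pieces ps & (nleaf ps, nedge ps) \in [:: (0, 1);
           (2, 0)])
  end.

Lemma extremal_weight t : extremal ((tree_order t).-1 %% 3) t ->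
  weight (potted_state t) = max_weight (tree_order t).-1.
Proof.
rewrite potted_stateE /max_weight /=.
case rE: (_ %% 3) => [|[|r]] /=.
- case=> ps tE [i0 j1 el].
  have -> : (tree_order t).-1 %/ 3 = (nbranch ps).+1
    by rewrite tE /= tree_order_of_pieces; lia.
  by rewrite tE /= statet_of_pieces i0 j1 el expnS /=; lia.
- case=> ps tE [i1 j1].
  have -> : (tree_order t).-1 %/ 3 = (nbranch ps).+1
    by rewrite tE /= tree_order_of_pieces; lia.
  by rewrite tE /= statet_of_pieces i1 j1 expnS /=; lia.
case=> -[ps tE]; rewrite !inE !xpair_eqE.
  move=> ijE; have -> : (tree_order t).-1 %/ 3 = (nbranch ps).+1.
    by rewrite tE /= tree_order_of_pieces; lia.
  rewrite tE /= statet_of_pieces expnS.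
  by case/or3P: ijE => /andP[/eqP-> /eqP->] /=; lia.
move=> ijE; have -> : (tree_order t).-1 %/ 3 = nbranch ps
  by rewrite tE tree_order_of_pieces; lia.
rewrite tE total_weight_of_pieces total_avoid_of_pieces.
by case/orP: ijE => /andP[/eqP-> /eqP->] /=; lia.
Qed.

(** If all components are pieces, the weight is a power of 3, plus 2 when none has one or two
    vertices. For a single large component, [strong] gives strictness unless all its root branches
    are pieces, when the closed formulas decide. Otherwise 2/3 + 2/9 < 1 applies. *)
Lemma weight_lt_or_extremal t : 4 < tree_order t ->
  weight (potted_state t) < max_weight (tree_order t).-1 \/
  extremal ((tree_order t).-1 %% 3) t.
Proof.
rewrite potted_stateE /= addn0 => N4.
have pow3 m : 0 < 3 ^ m by rewrite expn_gt0.
case: (forestP t) => [ps tE|c tE cE|q y].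
- rewrite tE total_weight_of_pieces total_avoid_of_pieces /max_weight; move: N4;
  rewrite tE tree_order_of_pieces /=.
  move iE: (nleaf ps) => i; move jE: (nedge ps) => j; move: (nbranch ps) => l N4.
  case rE: (_ %% 3) => [|[|r]] /=.
  + left; case: ifP => [/eqP ij0|ij].
      have -> : (i + 2 * j + 3 * l) %/ 3 = l by lia.
      by lia.
    have le : 3 ^ l <= 3 ^ ((i + 2 * j + 3 * l) %/ 3) by rewrite leq_exp2l //; lia.
    by lia.
  + left; have le : 3 ^ l <= 3 ^ ((i + 2 * j + 3 * l) %/ 3) by rewrite leq_exp2l //;
    lia.
    by case: ifP => ij; lia.
  have [ij2|ij5] : i + 2 * j = 2 \/ 5 <= i + 2 * j by lia.
    by right; right; exists ps; rewrite // iE jE !inE !xpair_eqE; lia.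
  left; have le : 3 ^ l.+1 <= 3 ^ ((i + 2 * j + 3 * l) %/ 3) by rewrite leq_exp2l //;
    lia.
  by move: le; rewrite expnS; case: ifP => ij; have := pow3 l; lia.
- rewrite tE /= muln1 addn1 /=; move: N4; rewrite tE /= addn1 ltnS => N4.
  case: (statet_bound c) => [[ps cps]|[]]; last first.
    have := positive_statet c; rewrite /crude_at /strong_at /max_weight /height.
    have : 0 < tree_order c %/ 3 by lia.
    have : (tree_order c %% 3) < 3 by rewrite ltn_pmod.
    have := pow3 (tree_order c %/ 3).
    move: (3 ^ (tree_order c %/ 3)) (tree_order c %/ 3) (tree_order c %% 3) =>
      h a r hp r3 a0 pos cr st; left.
    by case: r r3 cr st => [|[|[|//]]] _;
      case: (statet c) pos => [n u w|n v w|p v y] /=;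
      split_hyps; lia.
  rewrite /max_weight cps statet_of_pieces tree_order_of_pieces /=;
    rewrite cps tree_order_of_pieces in N4.
  have := exp3_lower (nbranch ps); have := nend_le_nbranch ps.
  move iE: (nleaf ps) => i; move jE: (nedge ps) => j.
  move eE: (nend ps) => e; move lE: (nbranch ps) => l le_el lt_l;
    rewrite iE jE lE in N4.
  (* Five vertices in branches of order one or two need at least three such branches. Sets of [c]
     containing its root then drop out, and the weight is [3 * 3 ^ l] against at least
     [3 ^ l.+2]. *)
  have [big|small] := leqP 5 (i + 2 * j).
    left; have -> : pieces_state i j l e = StC (3 ^ l) 0 0.
      by case: i j big {N4 iE jE} => [|[|[|i]]] [|[|[|j]]].
    have le : 3 ^ l.+2 <= 3 ^ ((i + 2 * j + 3 * l).+1 %/ 3) by rewrite leq_exp2l //;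
      lia.
    by move: le; rewrite !expnS /=; have := pow3 l; case: (_ %% 3) => [|[|r]]; lia.
  have -> : (i + 2 * j + 3 * l).+1 %/ 3 = (i + 2 * j).+1 %/ 3 + l by lia.
  have -> : (i + 2 * j + 3 * l).+1 %% 3 = (i + 2 * j).+1 %% 3 by lia.
  rewrite expnD.
  case: i small iE N4 => [|[|[|[|[|//]]]]]; case: j jE => [|[|[|//]]] // jE _ iE N4 /=;
   repeat (match goal with |- context [divn (S ?x) 3] =>
     let v := eval vm_compute in (divn (S x) 3) in change (divn (S x) 3) with v end);
   rewrite ?expn0 ?expn1;
   try (by left; lia);
   try (by right; left; exists ps; rewrite ?iE ?jE);
   try (by right; exists ps; rewrite ?iE ?jE).
  (* What remains is one two-vertex branch beside the [l] larger ones. The weight is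
     [3 ^ l.+1 + e + 2], so equality forces every larger branch to be a P_4. *)
  have [el|el] : e = l \/ e < l by lia.
    by right; exists ps; rewrite ?iE ?jE ?eE ?lE.
  by left; lia.
left; have := height_gt0 (tree_order t).-1; move: q y; rewrite /max_weight -/(height _).
by case: (_ %% 3) => [|[|r]]; lia.
Qed.

(** * Counting dissociation sets through a bridge *)

(** Rooted on the side of [B], so that [A] becomes a branch at the root, as in [Graft]. *)
Definition rjoin (A B : rooted_graph) : rooted_graph :=
  @RootedGraph (join_by_edge A B) (inr (root_vertex B)).

Lemma dissociationP (G : sgraph) (S : {set G}) :
  reflect {in S & &, forall x y z, adj x y -> adj x z -> y = z} (dissociation S).
Proof.
apply: (iffP idP) => [/bigmax_leqP maxS x y z xS yS zS xy xz|uniqS].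
  have := maxS (exist _ x xS) isT.
  move/card_le1_eqP=> /(_ (exist _ y yS) (exist _ z zS)); rewrite !inE => H.
  by have [] := H xy xz.
apply/bigmax_leqP => -[x xS] _; apply/card_le1_eqP => -[y yS] [z zS].
by rewrite !inE => xy xz; apply/val_inj/(uniqS x).
Qed.

Section Classes.
Variable R : rooted_graph.
Implicit Types S : {set R}.

Definition touched S := [exists y in S, adj (root_vertex R) y].

(** For a dissociation set: 0 if it misses the root, 1 if it isolates the root,
    2 if it matches it. *)
Definition rclass S := if root_vertex R \in S then (touched S).+1 else 0.

Definition dissociation_of i S := dissociation S && (rclass S == i).

End Classes.

Lemma untouchedP (R : rooted_graph) (S : {set R}) :
  reflect {in S, forall y, adj (root_vertex R) y = false} (~~ touched S).
Proof.
by apply: (iffP exists_inPn) => H y yS; [apply/negbTE/H | rewrite H].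
Qed.

(** [a] is only an upper bound on the sizes: it is not attained when [n = 0]. *)
Definition largest (T : finType) (P : pred {set T}) a n :=
  (forall S : {set T}, P S -> #|S| <= a) /\ #|[set S : {set T} | P S & #|S| == a]| = n.

Section Largest.
Variable T : finType.
Implicit Types P Q : pred {set T}.

Lemma eq_largest P Q a n : P =1 Q -> largest P a n -> largest Q a n.
Proof.
move=> PQ [le <-]; split=> [S|]; first by rewrite -PQ; apply: le.
by apply: eq_card => S; rewrite !inE PQ.
Qed.

Lemma largest_low P a b n : a < b -> largest P a n -> largest P b 0.
Proof.
move=> ab [le _]; split=> [S /le|]; first by lia.
by apply/eqP; rewrite cards_eq0 -subset0; apply/subsetP => S;
  rewrite !inE => /andP[/le]; lia.
Qed.

Lemma largestU P Q a n m : (forall S, ~~ (P S && Q S)) ->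
  largest P a n -> largest Q a m -> largest (fun S => P S || Q S) a (n + m).
Proof.
move=> dis [leP cP] [leQ cQ]; split=> [S /orP[/leP|/leQ]//|].
rewrite -cP -cQ -cardsUI.
rewrite [X in _ = _ + X](_ : _ = 0) ?addn0; last first.
  apply/eqP; rewrite cards_eq0 -subset0; apply/subsetP => S; rewrite !inE.
  by have := dis S; case: (P S) (Q S) => [] [] /=; rewrite ?andbF.
by apply: eq_card => S; rewrite !inE; case: (P S) (Q S) (#|S| == a) => [] [] [].
Qed.

End Largest.

Section Sum.
Variables A B : finType.
Implicit Types S : {set A + B}.

Definition lset S : {set A} := [set x | inl x \in S].
Definition rset S : {set B} := [set x | inr x \in S].

Lemma card_sum_set S : #|S| = #|lset S| + #|rset S|.
Proof.
rewrite -!sum1dep_card -[in LHS]sum1_card.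
by rewrite big_sumType.
Qed.

(** A set of size [a + b] must attain the bound in both halves, so such sets correspond to pairs. *)
Lemma largest_prod (P : pred {set A}) (Q : pred {set B}) a b n m :
  largest P a n -> largest Q b m ->
  largest (fun S => P (lset S) && Q (rset S)) (a + b) (n * m).
Proof.
move=> [leP cP] [leQ cQ]; split=> [S /andP[/leP ? /leQ ?]|].
  by rewrite card_sum_set leq_add.
rewrite -cP -cQ -cardsX.
pose f S := (lset S, rset S).
pose g (p : {set A} * {set B}) : {set A + B} :=
  [set x | match x with inl a => a \in p.1 | inr b => b \in p.2 end].
have fK : cancel f g by move=> S; apply/setP => -[x|x]; rewrite !inE.
have gK : cancel g f.
  by move=> [X Y]; congr (_, _); apply/setP => x; rewrite !inE.
rewrite -(card_imset _ (can_inj fK)); apply: eq_card => -[X Y].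
rewrite -[in RHS](gK (X, Y)) -[in LHS](gK (X, Y)) (mem_imset _ _ (can_inj fK)) !inE /=.
have := card_sum_set (g (X, Y)); have := leP (lset (g (X, Y)));
  have := leQ (rset (g (X, Y))).
case: (P _) => //= ; case: (Q _) => //=; rewrite ?andbF // => /(_ isT) ? /(_ isT) ? ->.
lia.
Qed.

End Sum.

Section Join.
Variables C T : rooted_graph.
Let J := rjoin C T.
Implicit Types S : {set J}.

(** The bridge matters only if both its ends are chosen; they then match each other and can have no
    other chosen neighbour. *)
Lemma join_dissociation S :
  dissociation S = [&& @dissociation C (lset S), @dissociation T (rset S) &
    (root_vertex C \in lset S) && (root_vertex T \in rset S) ==>
    ~~ @touched C (lset S) && ~~ @touched T (rset S)].
Proof.
apply/dissociationP/and3P.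
  move=> dS; split.
  - by apply/dissociationP => x y z; rewrite !inE => xS yS zS xy xz;
    have [] := dS _ _ _ xS yS zS xy xz.
  - by apply/dissociationP => x y z; rewrite !inE => xS yS zS xy xz;
    have [] := dS _ _ _ xS yS zS xy xz.
  rewrite !inE; apply/implyP => /andP[cS tS]; apply/andP; split;
    apply/untouchedP => y; rewrite inE => yS;
  apply/negbTE/negP => ay.
    by have := dS _ (inl y) (inr (root_vertex T)) cS yS tS ay;
      rewrite /= !eqxx => /(_ isT).
  by have := dS _ (inr y) (inl (root_vertex C)) tS yS cS ay;
    rewrite /= !eqxx => /(_ isT).
case=> /dissociationP dC /dissociationP dT /implyP; rewrite !inE => dR.
have un (c : C) (t : T) : inl c \in S -> inr t \in S -> adj (inl c : J) (inr t) ->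
    [/\ c = root_vertex C, t = root_vertex T,
        {in lset S, forall y, adj c y = false} & {in rset S, forall y, adj t y = false}].
  move=> cS tS /= /andP[/eqP cE /eqP tE]; rewrite cE tE in cS tS *.
  by have /andP[/untouchedP ? /untouchedP ?] := dR (introT andP (conj cS tS)).
have un' (c : C) (t : T) : inl c \in S -> inr t \in S -> adj (inr t : J) (inl c) ->
    [/\ c = root_vertex C, t = root_vertex T,
        {in lset S, forall y, adj c y = false} & {in rset S, forall y, adj t y = false}].
  by move=> ? ? ?; apply: un.
move=> [x|x] [y|y] [z|z] xS yS zS xy xz.
- by congr inl; apply: (dC x); rewrite ?inE.
- by have [_ _ /(_ y)] := un _ _ xS zS xz; rewrite inE yS [adj x y]xy => /(_ isT).
- by have [_ _ /(_ z)] := un _ _ xS yS xy; rewrite inE zS [adj x z]xz => /(_ isT).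
- by have [_ -> _ _] := un _ _ xS yS xy; have [_ -> _ _] := un _ _ xS zS xz.
- by have [-> _ _ _] := un' _ _ yS xS xy; have [-> _ _ _] := un' _ _ zS xS xz.
- by have [_ _ _ /(_ z)] := un' _ _ yS xS xy; rewrite inE zS [adj x z]xz => /(_ isT).
- by have [_ _ _ /(_ y)] := un' _ _ zS xS xz; rewrite inE yS [adj x y]xy => /(_ isT).
- by congr inr; apply: (dT x); rewrite ?inE.
Qed.

Lemma join_touched S : touched S = (root_vertex C \in lset S) || @touched T (rset S).
Proof.
apply/exists_inP/orP => [[[y|y] yS]|].
- by move=> /= /andP[/eqP <- _]; left; rewrite inE.
- by move=> ay; right; apply/exists_inP; exists y; rewrite ?inE.
case=> [|/exists_inP[y]]; rewrite inE.
  by move=> cS; exists (inl (root_vertex C)); rewrite //= !eqxx.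
by exists (inr y).
Qed.

Lemma join_root S : (root_vertex J \in S) = (root_vertex T \in rset S).
Proof. by rewrite inE. Qed.

Lemma join_class0 S :
  dissociation_of 0 S = @dissociation C (lset S) && @dissociation_of T 0 (rset S).
Proof.
rewrite /dissociation_of /rclass join_dissociation join_touched join_root.
case: (root_vertex T \in _) => //=; rewrite ?andbF ?andbT //.
Qed.

Lemma join_class1 S :
  dissociation_of 1 S = @dissociation_of C 0 (lset S) && @dissociation_of T 1 (rset S).
Proof.
rewrite /dissociation_of /rclass join_dissociation join_touched join_root.
case: (root_vertex T \in _) => //=; rewrite ?andbF ?andbT //.
by case: (dissociation _); case: (dissociation _); case: (_ \in _);
  case: (touched _); case: (touched _).
Qed.

Lemma join_class2 S :
  dissociation_of 2 S = @dissociation_of C 0 (lset S) && @dissociation_of T 2 (rset S)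
    || @dissociation_of C 1 (lset S) && @dissociation_of T 1 (rset S).
Proof.
rewrite /dissociation_of /rclass join_dissociation join_touched join_root.
by case: (root_vertex T \in _); case: (dissociation _); case: (dissociation _);
  case: (_ \in _); case: (touched _); case: (touched _).
Qed.

End Join.

Lemma dissociation_split (R : rooted_graph) (S : {set R}) :
  dissociation S = [|| dissociation_of 0 S, dissociation_of 1 S | dissociation_of 2 S].
Proof.
by rewrite /dissociation_of /rclass; case: (dissociation _) => //=; case: (_ \in S);
  case: (touched S).
Qed.

Lemma largest_dissociation (R : rooted_graph) a n m k :
  largest (@dissociation_of R 0) a n -> largest (@dissociation_of R 1) a m ->
    largest (@dissociation_of R 2) a k ->
  largest (@dissociation R) a (n + m + k).
Proof.
move=> t0 t1 t2; apply: (eq_largest (P := fun S =>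
  (dissociation_of 0 S || dissociation_of 1 S) || dissociation_of 2 S)).
  by move=> S; rewrite dissociation_split orbA.
by apply: largestU (largestU _ t0 t1) t2 => S; rewrite /dissociation_of;
  case: (dissociation S) => //=; case: (rclass S) => [|[|[]]].
Qed.

Definition represents_at (R : rooted_graph) d s :=
  match s with
  | StA n u w =>
      [/\ largest (@dissociation_of R 0) d n,
          largest (@dissociation_of R 1) d.+1 u
        & largest (@dissociation_of R 2) d.+1 w]
  | StB n v w =>
      [/\ largest (@dissociation_of R 0) d n,
          largest (@dissociation_of R 1) d v
        & largest (@dissociation_of R 2) d.+1 w]
  | StC p v y =>
      [/\ largest (@dissociation_of R 0) d p,
          largest (@dissociation_of R 1) d v
        & largest (@dissociation_of R 2) d y]
  end.

Definition represents R s := exists d, represents_at R d s.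

Lemma represents_weight R d s : represents_at R d s ->
  largest (@dissociation R) (if s is StC _ _ _ then d else d.+1) (weight s).
Proof.
case: s => [n u w|n v w|p v y] [t0 t1 t2].
- exact: largest_dissociation (largest_low (ltnSn d) t0) t1 t2.
- exact: largest_dissociation (largest_low (ltnSn d) t0) (largest_low (ltnSn d) t1) t2.
- exact: largest_dissociation t0 t1 t2.
Qed.

(** Positivity ensures that the upper bound recorded by [largest] is attained, hence is the maximum
    size. *)
Lemma represents_num (R : rooted_graph) s : represents R s -> 0 < weight s ->
  num_max_dissociation R = weight s.
Proof.
move=> [d] /represents_weight[le cd] pos.
rewrite -cd; apply: eq_card => S; rewrite !inE /max_dissociation.
case dS: (dissociation S) => //=.
move: pos; rewrite -cd => /card_gt0P[S0]; rewrite inE => /andP[dS0 /eqP cS0].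
apply/forallP/eqP => [/(_ S0)|cS S']; last by apply/implyP; rewrite cS; apply: le.
by rewrite dS0 cS0 /= => ?; apply/eqP; rewrite eqn_leq le.
Qed.

(** The factor [(a == b)] discards products of too small a size, which lets all pairs of states be
    treated alike. *)
Lemma largest_lift (T : finType) (P : pred {set T}) a n b :
  largest P a n -> a <= b -> largest P b ((a == b) * n).
Proof.
move=> tP; rewrite leq_eqVlt => /orP[/eqP <-|ab]; first by rewrite eqxx mul1n.
by rewrite (ltn_eqF ab); apply: largest_low tP.
Qed.

Lemma represents_join C T c t :
  represents C c -> represents T t -> represents (rjoin C T) (step c t).
Proof.
move=> [dC rC] [dT rT]; have tweight := represents_weight rC.
have tJ0 a n b m : largest (@dissociation C) a n ->
  largest (@dissociation_of T 0) b m ->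
    largest (@dissociation_of (rjoin C T) 0) (a + b) (n * m).
  by move=> ta tb; apply: eq_largest (largest_prod ta tb) => S; rewrite join_class0.
have tJ1 a n b m k : largest (@dissociation_of C 0) a n ->
  largest (@dissociation_of T 1) b m -> a + b <= k ->
    largest (@dissociation_of (rjoin C T) 1) k ((a + b == k) * (n * m)).
  move=> ta tb; apply: largest_lift.
  by apply: eq_largest (largest_prod ta tb) => S; rewrite join_class1.
have tJ2 a n b m a' n' b' m' k : largest (@dissociation_of C 0) a n ->
  largest (@dissociation_of T 2) b m ->
    largest (@dissociation_of C 1) a' n' -> largest (@dissociation_of T 1) b' m' ->
      a + b <= k -> a' + b' <= k ->
    largest (@dissociation_of (rjoin C T) 2) k
      ((a + b == k) * (n * m) + (a' + b' == k) * (n' * m')).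
  move=> ta tb ta' tb' le le'.
  apply: (eq_largest _ (largestU _ (largest_lift (largest_prod ta tb) le)
    (largest_lift (largest_prod ta' tb') le'))).
    by move=> S; rewrite join_class2.
  by move=> S; apply/negP => /andP[/andP[/andP[_ /eqP c0] _] /andP[/andP[_]]];
    rewrite c0.
have top_val (P : pred {set rjoin C T}) a n m : largest P a n -> n = m -> largest P a m.
  by move=> ? <-.
(* The base size of the join is found by unification in the first class; the other two classes are
   then compared with it. *)
case: c rC tweight => [n u w|n v w|p v y] [c0 c1 c2] tw;
case: t rT => [n' u' w'|n' v' w'|p' v' y'] [t0 t1 t2]; eexists; split;
  try (by apply: (tJ0 _ _ _ _ tw t0)).
all: try (apply: top_val; [apply: (tJ1 _ _ _ _ _ c0 t1); lia|]; case: eqP => ?;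
  rewrite ?mul1n //; lia).
all: apply: top_val; [apply: (tJ2 _ _ _ _ _ _ _ _ _ c0 t2 c1 t1); lia|];
  repeat (case: eqP => ?); rewrite ?mul1n ?add0n ?addn0 //; lia.
Qed.

(** * Dissociation sets of a cycle *)

Section CycleCount.
Variables (k : nat) (v : Cycle k).
Hypotheses (k_gt0 : 0 < k) (k_mod3 : k %% 3 = 0).

Let t := k %/ 3.
Let kE : k = 3 * t. Proof. by rewrite /t; lia. Qed.

Definition wrap (m : nat) : Cycle k := Ordinal (ltn_pmod m k_gt0).

Lemma wrap_val (x : Cycle k) : wrap x = x.
Proof. by apply: val_inj; rewrite /= modn_small. Qed.

Lemma ordS_wrap m : ordS (wrap m) = wrap m.+1.
Proof. by apply: val_inj; rewrite /= -addn1 modnDml addn1. Qed.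

Lemma wrap_neq m n : m < n -> n < m + k -> wrap m != wrap n.
Proof.
move=> mn nmk; apply/eqP => /(congr1 val) /= E.
have : k %| n - m by rewrite -eqn_mod_dvd ?(ltnW mn) // E.
by move/dvdn_leq; lia.
Qed.

Lemma adj_wrap m : adj (wrap m) (wrap m.+1).
Proof. by rewrite /= /cycle_adj ordS_wrap eqxx orTb andbT wrap_neq; lia. Qed.

(** Residues modulo 3 make sense around the cycle because 3 divides [k]. *)
Lemma wrap_mod3 m : wrap m %% 3 = m %% 3.
Proof. by rewrite /= modn_dvdm //; apply/dvdnP; exists t; lia. Qed.

(** Combined with [triple_le2], this gives [#|S| <= 2 * t]; in case of equality every
    triple meets [S] in exactly two vertices, so that [S] has period 3. *)
Lemma sum_triples (S : {set Cycle k}) :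
  \sum_(x : Cycle k) ((x \in S) + (ordS x \in S) + (ordS (ordS x) \in S)) = 3 * #|S|.
Proof.
have sumS : \sum_(x : Cycle k) (x \in S) = #|S| by rewrite -sum1_card [RHS]big_mkcond.
have sumS1 : \sum_(x : Cycle k) (ordS x \in S) = #|S|.
  by rewrite -sumS [RHS](reindex_inj (@ordS_inj k)).
have sumS2 : \sum_(x : Cycle k) (ordS (ordS x) \in S) = #|S|.
  by rewrite -sumS1 [RHS](reindex_inj (@ordS_inj k)).
by rewrite !big_split /= sumS sumS1 sumS2 !mulSn mul0n addn0 addnA.
Qed.

(** Otherwise the middle vertex would have two chosen neighbours, which are distinct as [k] is at
    least 3. *)
Lemma triple_le2 (S : {set Cycle k}) (x : Cycle k) : dissociation S ->
  (x \in S) + (ordS x \in S) + (ordS (ordS x) \in S) <= 2.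
Proof.
rewrite -(wrap_val x) !ordS_wrap; move: (nat_of_ord x) => m /dissociationP dS.
case m0: (wrap m \in S) => //=; case m1: (wrap m.+1 \in S) => //=;
  case m2: (wrap m.+2 \in S) => //=.
have := dS _ _ _ m1 m0 m2; rewrite (adj_sym (wrap m.+1)) !adj_wrap => /(_ isT isT) /eqP.
by rewrite (negbTE (wrap_neq _ _)) //; lia.
Qed.

Lemma cycle_dissociation_le (S : {set Cycle k}) : dissociation S -> #|S| <= 2 * t.
Proof.
move=> dS; have : 3 * #|S| <= 3 * (2 * t); last by lia.
rewrite -sum_triples; apply: (@leq_trans (\sum_(x : Cycle k) 2)).
  by apply: leq_sum => x _; apply: triple_le2.
by rewrite sum_nat_const card_ord; lia.
Qed.

Definition periodic (j : 'I_3) : {set Cycle k} := [set x : 'I_k | x %% 3 != j].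

Lemma periodic_wrap j m : (wrap m \in periodic j) = (m %% 3 != j).
Proof. by rewrite inE wrap_mod3. Qed.

Lemma periodic_inj : injective periodic.
Proof.
move=> i j /setP/(_ (wrap i)); rewrite !periodic_wrap modn_small // eqxx /=.
by move/esym/negbT; rewrite negbK => /eqP/val_inj.
Qed.

Lemma card_periodic j : #|periodic j| = 2 * t.
Proof.
have : 3 * #|periodic j| = 3 * (2 * t); last by lia.
rewrite -sum_triples (eq_bigr (fun=> 2)).
  by rewrite sum_nat_const card_ord; lia.
move=> x _; rewrite -(wrap_val x) !ordS_wrap !periodic_wrap.
by have := ltn_ord j; lia.
Qed.

Lemma adj_cycleP (x y : Cycle k) : adj x y -> y = wrap x.+1 \/ x = wrap y.+1.
Proof. by move=> /andP[_ /orP[]/eqP <-]; [left|right]; rewrite -ordS_wrap wrap_val. Qed.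

Lemma dissociation_periodic j : dissociation (periodic j).
Proof.
have wrapS_inj (a b : Cycle k) : wrap a.+1 = wrap b.+1 -> a = b.
  by rewrite -!ordS_wrap !wrap_val => /ordS_inj.
have mod3 (a b : Cycle k) : a = wrap b.+1 -> a %% 3 = b.+1 %% 3 by move=> ->;
  rewrite wrap_mod3.
apply/dissociationP => x y z; rewrite !inE.
move=> xj yj zj /adj_cycleP[yE|xE] /adj_cycleP[zE|xE'].
- by rewrite yE zE.
- by exfalso; have := mod3 _ _ yE; have := mod3 _ _ xE'; have := ltn_ord j; lia.
- by exfalso; have := mod3 _ _ zE; have := mod3 _ _ xE; have := ltn_ord j; lia.
- by apply: wrapS_inj; rewrite -xE -xE'.
Qed.

Lemma max_dissociation_periodic (S : {set Cycle k}) :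
  dissociation S -> #|S| = 2 * t -> exists j, S = periodic j.
Proof.
move=> dS cS.
have two m : (wrap m \in S) + (wrap m.+1 \in S) + (wrap m.+2 \in S) = 2.
  have := leqif_sum (fun x (_ : true) => leqif_eq (triple_le2 x dS)).
  move=> /= [_]; rewrite sum_triples sum_nat_const card_ord cS.
  have -> : (3 * (2 * t) == k * 2) by lia.
  by move/esym/forallP/(_ (wrap m)); rewrite !ordS_wrap => /eqP.
(* The triples starting at [m - 3] and [m - 2] share two vertices, so [m - 3] and [m] are both in
   [S] or both outside. *)
have per m : (wrap m \in S) = (wrap (m %% 3) \in S).
  elim/ltn_ind: m => m IH; have [lt|ge] := ltnP m 3; first by rewrite modn_small.
  have -> : m %% 3 = (m - 3) %% 3 by lia.
  rewrite -IH; last by lia.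
  have := two (m - 3); have := two (m - 2).
  have -> : (m - 3).+1 = m - 2 by lia.
  have -> : (m - 2).+1 = m - 1 by lia.
  have -> : (m - 1).+1 = m by lia.
  by case: (wrap _ \in S) (wrap _ \in S) (wrap _ \in S) (wrap _ \in S) => [] [] [] [].
have [j jE] : exists j : 'I_3, forall i : 'I_3, (wrap i \in S) = (i != j).
  have := two 0; case b0: (wrap 0 \in S); case b1: (wrap 1 \in S);
    case b2: (wrap 2 \in S) => //= _.
  - by exists (Ordinal (isT : 2 < 3)) => -[[|[|[|//]]] lt]; rewrite -val_eqE /=.
  - by exists (Ordinal (isT : 1 < 3)) => -[[|[|[|//]]] lt]; rewrite -val_eqE /=.
  - by exists (Ordinal (isT : 0 < 3)) => -[[|[|[|//]]] lt]; rewrite -val_eqE /=.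
exists j; apply/setP => x; rewrite -(wrap_val x) periodic_wrap per.
by rewrite (jE (Ordinal (ltn_pmod x (isT : 0 < 3)))).
Qed.

Let R := RootedGraph v.

Lemma rclass_periodic j : @rclass R (periodic j) = if v %% 3 == j then 0 else 2.
Proof.
rewrite /rclass -[root_vertex R]/v -{1}(wrap_val v) periodic_wrap; case: eqP => //= vj.
suff -> : @touched R (periodic j) by [].
apply/exists_inP; have [s|s] := eqVneq (v.+1 %% 3) j; last first.
  exists (wrap v.+1); first by rewrite periodic_wrap.
  by have := adj_wrap v; rewrite wrap_val.
(* If the successor of [v] is left out, its predecessor is not; adding [k] keeps the index
   nonnegative. *)
exists (wrap (v + k).-1); first by rewrite periodic_wrap; have := ltn_ord j; lia.
have := adj_wrap (v + k).-1; rewrite prednK ?addn_gt0 ?k_gt0 ?orbT //.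
by rewrite (_ : wrap (v + k) = v) 1?adj_sym //; apply: val_inj;
  rewrite /= modnDr modn_small.
Qed.

Lemma dissociation_of_cycle i (J : {set 'I_3}) :
  (forall j, (@rclass R (periodic j) == i) = (j \in J)) ->
  largest (@dissociation_of R i) (2 * t) #|J|.
Proof.
move=> iJ; split=> [S /andP[dS _]|]; first exact: cycle_dissociation_le.
rewrite -(card_imset _ periodic_inj); apply: eq_card => S; rewrite !inE.
apply/idP/imsetP => [/andP[/andP[dS iS] /eqP cS]|[j jJ ->]].
  have [j jE] := max_dissociation_periodic dS cS.
  by exists j => //; rewrite -iJ -jE.
by rewrite /dissociation_of dissociation_periodic iJ jJ card_periodic eqxx.
Qed.

Lemma represents_cycle : represents R (StC 1 0 2).
Proof.
pose j0 : 'I_3 := Ordinal (ltn_pmod v (isT : 0 < 3)).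
have jE (j : 'I_3) : (v %% 3 == j) = (j == j0) by rewrite eq_sym.
exists (2 * t); split.
- have := @dissociation_of_cycle 0 [set j0]; rewrite cards1; apply => j.
  by rewrite rclass_periodic jE inE; case: (j == j0).
- have := @dissociation_of_cycle 1 set0; rewrite cards0; apply => j.
  by rewrite rclass_periodic jE inE; case: (j == j0).
- have := @dissociation_of_cycle 2 (~: [set j0]); rewrite cardsC1 card_ord; apply => j.
  by rewrite rclass_periodic jE !inE; case: (j == j0).
Qed.

End CycleCount.

(** * Planting trees *)

Lemma iso_sym (G H : sgraph) : iso G H -> iso H G.
Proof.
move=> [f [[g fK gK] fE]]; exists g; split; first by exists f.
by move=> x y; rewrite -fE !gK.
Qed.

Lemma iso_trans (G H K : sgraph) : iso G H -> iso H K -> iso G K.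
Proof.
move=> [f [fb fE]] [g [gb gE]]; exists (g \o f); split; first exact: bij_comp.
by move=> x y; rewrite /= gE fE.
Qed.

Lemma iso_card (G H : sgraph) : iso G H -> #|G| = #|H|.
Proof. by move=> [f [fb _]]; apply: bij_eq_card fb. Qed.

Lemma dissociation_imset (G H : sgraph) (f : G -> H) (S : {set G}) :
  (forall x y, adj (f x) (f y) = adj x y) -> dissociation S -> dissociation (f @: S).
Proof.
move=> fE /dissociationP dS;
  apply/dissociationP => _ _ _ /imsetP[x xS ->] /imsetP[y yS ->] /imsetP[z zS ->].
by rewrite !fE => xy xz; rewrite (dS x y z).
Qed.

Lemma num_max_dissociation_le (G H : sgraph) :
  iso G H -> num_max_dissociation G <= num_max_dissociation H.
Proof.
move=> [f [[g fK gK] fE]].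
have gE x y : adj (g x) (g y) = adj x y by rewrite -fE !gK.
have fI := can_inj fK; have gI := can_inj gK.
rewrite /num_max_dissociation -(card_imset _ (imset_inj fI)).
apply/subset_leq_card/subsetP => _ /imsetP[S + ->].
rewrite !inE => /andP[dS /forallP maxS];
  rewrite /max_dissociation dissociation_imset //=.
apply/forallP => S'; apply/implyP => dS'.
rewrite (card_imset _ fI) -(card_imset _ gI).
by apply: (implyP (maxS _)); apply: dissociation_imset.
Qed.

Lemma num_max_dissociation_iso (G H : sgraph) :
  iso G H -> num_max_dissociation G = num_max_dissociation H.
Proof.
by move=> GH; apply/eqP; rewrite eqn_leq !num_max_dissociation_le //; apply: iso_sym.
Qed.

Definition riso (A B : rooted_graph) : Prop :=
  exists f : A -> B, [/\ bijective f, forall x y, adj (f x) (f y) = adj x y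
    & f (root_vertex A) = root_vertex B].

Lemma riso_inj (A B : rooted_graph) (f : A -> B) :
  injective f -> #|B| <= #|A| -> (forall x y, adj (f x) (f y) = adj x y) ->
  f (root_vertex A) = root_vertex B -> riso A B.
Proof. by move=> fI le fE fr; exists f; split=> //; apply: inj_card_bij. Qed.

Lemma riso_iso (A B : rooted_graph) : riso A B -> iso A B.
Proof. by move=> [f [fb fE _]]; exists f. Qed.

Lemma riso_refl A : riso A A.
Proof. by exists id; split=> //; exists id. Qed.

Lemma riso_sym A B : riso A B -> riso B A.
Proof.
move=> [f [[g fK gK] fE fr]]; exists g; split; first by exists f.
  by move=> x y; rewrite -fE !gK.
by rewrite -fr fK.
Qed.

Lemma riso_trans A B C : riso A B -> riso B C -> riso A C.
Proof.
move=> [f [fb fE fr]] [g [gb gE gr]]; exists (g \o f); split; first exact: bij_comp.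
  by move=> x y; rewrite /= gE fE.
by rewrite /= fr.
Qed.

Lemma riso_card (A B : rooted_graph) : riso A B -> #|A| = #|B|.
Proof. by move/riso_iso/iso_card. Qed.

Lemma card_rjoin A B : #|rjoin A B| = #|A| + #|B|.
Proof. by rewrite card_sum. Qed.

Lemma rjoin_riso A A' B B' : riso A A' -> riso B B' -> riso (rjoin A B) (rjoin A' B').
Proof.
move=> hA hB; have := (riso_card hA, riso_card hB).
case: hA hB => [f [/bij_inj fI fE fr]] [g [/bij_inj gI gE gr]] [cA cB].
apply: (@riso_inj (rjoin A B) (rjoin A' B')
  (fun x => match x with inl a => inl (f a) | inr b => inr (g b) end)).
- by move=> [a|b] [a'|b'] // [] => [/fI|/gI] ->.
- by rewrite !card_rjoin cA cB.
- by move=> [a|b] [a'|b'] /=; rewrite ?fE ?gE // -fr -gr (inj_eq fI) (inj_eq gI).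
- by rewrite /= gr.
Qed.

Lemma rjoin_swap A B C : riso (rjoin A (rjoin B C)) (rjoin B (rjoin A C)).
Proof.
apply: (@riso_inj (rjoin A (rjoin B C)) (rjoin B (rjoin A C)) (fun x => match x with
  | inl a => inr (inl a) | inr (inl b) => inl b | inr (inr c) => inr (inr c) end)).
- by move=> [a|[b|c]] [a'|[b'|c']] // [] ->.
- by rewrite !card_rjoin addnCA.
- by move=> [a|[b|c]] [a'|[b'|c']] //=; rewrite ?andbF.
- by [].
Qed.

Lemma join_by_edgeC A B : iso (join_by_edge A B) (rjoin B A).
Proof.
exists (fun x => match x with inl a => inr a | inr b => inl b end); split.
  by exists (fun x => match x with inl a => inr a | inr b => inl b end); case.
by move=> [a|b] [a'|b'] //=; rewrite andbC.
Qed.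

Definition point := @RootedGraph (Path 1) ord0.

(** The graph whose counts [state_from] computes: [t] with its root replaced by [B]. *)
Fixpoint plant (B : rooted_graph) t : rooted_graph :=
  if t is Graft c t' then rjoin (plant point c) (plant B t') else B.

Lemma card_plant B t : #|plant B t| = #|B| + (tree_order t).-1.
Proof.
elim: t B => [|c IHc t IHt] B; first by rewrite addn0.
rewrite [plant _ _]/= card_rjoin IHc IHt card_ord /=.
by have := tree_order_gt0 c; have := tree_order_gt0 t; lia.
Qed.

Lemma represents_point : represents point (StA 1 1 0).
Proof.
have E0 (S : {set point}) : #|S| = (ord0 \in S).
  have [h|h] := boolP (ord0 \in S).
    apply/eqP; rewrite eqn_leq card_gt0 (leq_trans (max_card _)) ?card_ord //=.
    by apply/set0Pn; exists ord0.
  by apply/eqP; rewrite cards_eq0 -subset0; apply/subsetP => x;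
    rewrite (ord1 x) (negbTE h).
have dS (S : {set point}) : dissociation S.
  by apply/dissociationP => x y z _ _ _ _ _; rewrite (ord1 y) (ord1 z).
have cS (S : {set point}) : rclass S = (ord0 \in S).
  rewrite /rclass; case: ifP => // _; suff -> : touched S = false by [].
  by apply/exists_inP => -[y _]; rewrite (ord1 y) adj_irrefl.
have fS i (S : {set point}) : dissociation_of i S = ((ord0 \in S) == i :> nat)
  by rewrite /dissociation_of dS cS.
exists 0; split; split=> [S|]; rewrite ?fS ?E0; try by case: (_ \in _).
- rewrite -[RHS](cards1 (set0 : {set point})); apply: eq_card => S; rewrite !inE fS.
  by rewrite -cards_eq0 E0; case: (_ \in _).
- rewrite -[RHS](cards1 (setT : {set point})); apply: eq_card => S; rewrite !inE fS.
  by rewrite eqEcard subsetT cardsT card_ord E0; case: (_ \in _).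
- apply/eqP; rewrite cards_eq0 -subset0; apply/subsetP => S; rewrite !inE fS.
  by case: (_ \in _).
Qed.

Lemma represents_plant B b t : represents B b ->
  represents (plant B t) (state_from b t).
Proof.
elim: t B b => [|c IHc t IHt] B b rB //=.
by apply: represents_join; [apply/IHc/represents_point|apply: IHt].
Qed.

Lemma plant_perm B ps qs :
  perm_eq ps qs -> riso (plant B (of_pieces ps)) (plant B (of_pieces qs)).
Proof.
have move_front p qs1 qs2 :
    riso (plant B (of_pieces (p :: qs1 ++ qs2)))
      (plant B (of_pieces (qs1 ++ p :: qs2))).
  elim: qs1 => [|q qs1 IH]; first exact: riso_refl.
  by apply: riso_trans (rjoin_swap _ _ _) _; apply: rjoin_riso IH; apply: riso_refl.
elim: ps qs => [|p ps IH] qs pq.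
  by move/perm_size: pq => /esym/size0nil ->; apply: riso_refl.
have pqs : p \in qs by rewrite -(perm_mem pq) mem_head.
case/splitPr: pqs pq => q1 q2;
  rewrite perm_sym -cat1s perm_catCA perm_cons perm_sym => pq.
apply: riso_trans (move_front p q1 q2).
by apply: rjoin_riso (riso_refl _) (IH _ pq).
Qed.

(** * Trees with identified leaves *)

Lemma card_identify (A B : rooted_graph) : #|identify A B| = #|A| + #|B|.-1.
Proof.
rewrite card_sum card_sig; congr (_ + _).
by rewrite (cardC1 (root_vertex B)).
Qed.

(** [rjoin C point] says that the root of [A] is a leaf whose neighbour is the root of [C].
    Identifying that leaf with another root turns its edge into a bridge to [C]. *)
Lemma identify_pendant A C B B' :
  riso A (rjoin C point) -> riso B B' -> riso (identify A B) (rjoin C B').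
Proof.
move=> hA hB; have := (riso_card hA, riso_card hB).
case: hA hB => [f [/bij_inj fI fE fr]] [g [/bij_inj gI gE gr]] [cA cB].
have Bpos : 0 < #|B| by apply/card_gt0P; exists (root_vertex B).
apply: (@riso_inj (identify A B) (rjoin C B') (fun x => match x with
  | inl a => match f a with inl c => inl c | inr _ => inr (root_vertex B') end
  | inr b => inr (g (val b)) end)).
- have fI' a a' i : f a = inr i -> f a' = inr i -> a = a' by move=> <- /fI.
  move=> [a|[b bn]] [a'|[b' bn']] /=.
  + case fa: (f a) => [c|i]; case fa': (f a') => [c'|i'] //.
      by case=> ?; subst c'; congr inl; apply: fI; rewrite fa fa'.
    by move=> _; congr inl; apply: fI; rewrite fa fa' (ord1 i) (ord1 i').
  + by case: (f a) => [c|i] // [] /esym; rewrite -gr => /gI E; case/eqP: (bn').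
  + by case: (f a') => [c|i] // []; rewrite -gr => /gI E; case/eqP: (bn).
  + by case=> /gI E; subst b'; congr inr; apply: val_inj.
- by rewrite card_rjoin card_identify cA card_rjoin card_ord cB; rewrite cB in Bpos;
  lia.
- have rA a i : f a = inr i -> a = root_vertex A.
    by move=> fa; apply: fI; rewrite fa fr (ord1 i).
  have nrA a c : f a = inl c -> a != root_vertex A.
    by move=> fa; apply/eqP => E; rewrite E fr in fa.
  have arA a c : f a = inl c -> adj a (root_vertex A) = (c == root_vertex C).
    by move=> fa; rewrite -fE fa fr /= andbT.
  move=> [a|[b bn]] [a'|[b' bn']] /=.
  + case fa: (f a) => [c|i]; case fa': (f a') => [c'|i'] /=.
    * by rewrite -fE fa fa'.
    * by rewrite (rA _ _ fa') (arA _ _ fa) eqxx andbT.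
    * by rewrite (rA _ _ fa) adj_sym (arA _ _ fa') eqxx andbT.
    * by rewrite (rA _ _ fa) (rA _ _ fa') !adj_irrefl.
  + case fa: (f a) => [c|i] /=.
      by rewrite (negbTE (nrA _ _ fa)) -gr (inj_eq gI) (negbTE bn') andbF.
    by rewrite (rA _ _ fa) eqxx -gr gE.
  + case fa: (f a') => [c|i] /=.
      by rewrite (negbTE (nrA _ _ fa)) -gr (inj_eq gI) (negbTE bn) andbF.
    by rewrite (rA _ _ fa) eqxx -gr gE adj_sym.
  + by rewrite gE.
- by rewrite /= fr.
Qed.

Lemma identify_riso A B B' : riso B B' -> riso (identify A B) (identify A B').
Proof.
move=> [g [gb gE gr]]; have gI := bij_inj gb.
have nr (b : {b : B | b != root_vertex B}) : g (val b) != root_vertex B'.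
  by rewrite -gr (inj_eq gI); exact: (valP b).
apply: (@riso_inj (identify A B) (identify A B') (fun x => match x with
  | inl a => inl a | inr b => inr (exist _ (g (val b)) (nr b)) end)).
- by move=> [a|b] [a'|b'] // [] => [->|/gI/val_inj ->].
- by rewrite !card_identify (bij_eq_card gb).
- by move=> [a|b] [a'|b'] //=; rewrite -?gr gE.
- by [].
Qed.

Lemma identify_point B : riso (identify B point) B.
Proof.
have no (b : {b : point | b != root_vertex point}) : False.
  by case: b => b; rewrite (ord1 b).
apply: (@riso_inj (identify B point) B
  (fun x => match x with inl b => b | inr b => False_rect _ (no b) end)).
- by move=> [a|b] [a'|b'] //= ->.
- by rewrite card_identify leq_addr.
- by move=> [a|b] [a'|b'].
- by [].
Qed.

Lemma identify_rjoin B C R : riso (identify B (rjoin C R)) (rjoin C (identify B R)).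
Proof.
apply: riso_sym.
have nr (r : {r : R | r != root_vertex R}) :
    (inr (val r) : rjoin C R) != root_vertex (rjoin C R) by apply: (valP r).
apply: (@riso_inj (rjoin C (identify B R)) (identify B (rjoin C R)) (fun x =>
  match x with
  | inl c => inr (exist _ (inl c : rjoin C R) isT)
  | inr (inl b) => inl b
  | inr (inr r) => inr (exist _ (inr (val r) : rjoin C R) (nr r)) end)).
- by move=> [c|[b|r]] [c'|[b'|r']] // [] => [->|->|/val_inj ->].
- rewrite card_identify !card_rjoin card_identify.
  by have : 0 < #|R| by [apply/card_gt0P; exists (root_vertex R)]; lia.
- move=> [c|[b|r]] [c'|[b'|r']] //=; rewrite ?eqxx ?andbT //.
  + by rewrite andbC.
  + by rewrite (_ : val r' == _ = false) ?andbF;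
    [case: (c == _)|apply: negbTE (valP r')].
  + by rewrite andbC.
  + by rewrite (_ : val r == _ = false) ?andbF;
    [case: (c' == _)|apply: negbTE (valP r)].
- by [].
Qed.

Lemma identify_plant B t : riso (identify B (plant point t)) (plant B t).
Proof.
elim: t => [|c _ t IH]; first exact: identify_point.
by apply: riso_trans (identify_rjoin _ _ _) _; apply: rjoin_riso IH; apply: riso_refl.
Qed.

Definition piece_graph (p : piece) : sgraph :=
  match p with
  | (false, false) => Path 2
  | (false, true) => Path 3
  | (true, true) => Path 4
  | (true, false) => complete_bipartite 1 3
  end.

Lemma leaf_uniq (G : sgraph) (x y z : G) : is_leaf x -> adj x y -> adj x z -> y = z.
Proof.
by rewrite /is_leaf /degree => /eqP/eq_leq/card_le1_eqP H xy xz; apply: H; rewrite inE.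
Qed.

Lemma piece_pendant p (x : piece_graph p) :
  is_leaf x -> riso (RootedGraph x) (rjoin (plant point (piece_tree p)) point).
Proof.
move=> xl; apply: riso_sym; have xu := @leaf_uniq _ x _ _ xl; move: x xl xu.
case: p => [[] []] /= x xl xu.
(* [s m] is the vertex at distance [m] from the chosen leaf; interior vertices are excluded because
   they have two neighbours. *)
- pose s m : 'I_4 := if x == ord0 then inord m else inord (3 - m).
  have xE : x = s 0.
    case: x @s xl xu => [[|[|[|[|//]]]] lt] //= _ xu; apply: val_inj;
      rewrite /= ?inordK //.
    + by have := xu (@Ordinal 4 0 isT) (@Ordinal 4 2 isT) isT isT.
    + by have := xu (@Ordinal 4 1 isT) (@Ordinal 4 3 isT) isT isT.
  have sE m n : m < 4 -> n < 4 -> adj (s m : Path 4) (s n) = (m.+1 == n) || (n.+1 == m).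
    move=> m4 n4; rewrite /= /path_adj /s; case: ifP => _; rewrite !inordK; lia.
  have sI m n : m < 4 -> n < 4 -> s m = s n -> m = n.
    by move=> m4 n4; rewrite /s; case: ifP => _ /(congr1 val); rewrite /= !inordK; lia.
  apply: (@riso_inj (rjoin (rjoin (rjoin point point) point) point)
    (RootedGraph (x : Path 4)) (fun y => match y with
    | inr _ => s 0 | inl (inr _) => s 1
    | inl (inl (inr _)) => s 2 | inl (inl (inl _)) => s 3 end)).
  + by move=> [[[a|a]|a]|a] [[[b|b]|b]|b] /sI E; rewrite ?(ord1 a) ?(ord1 b) //;
    have := E isT isT.
  + by rewrite !card_rjoin !card_ord.
  + by move=> [[[a|a]|a]|a] [[[b|b]|b]|b]; rewrite (ord1 a) (ord1 b) sE.
  + by [].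
- case: x xl xu => [c|i] xl xu.
    by have := xu (inr (@Ordinal 3 0 isT)) (inr (@Ordinal 3 1 isT)) isT isT.
  (* The leaves of the star are rotated so that [s 0] is the chosen one. *)
  pose s m : 'I_3 := inord ((i + m) %% 3).
  have sI m n : m < 3 -> n < 3 -> s m = s n -> m = n.
    by move=> m3 n3 /(congr1 val); rewrite /= !inordK ?ltn_pmod //; lia.
  have s0 : s 0 = i by apply: val_inj; rewrite /= inordK addn0 ?ltn_pmod // modn_small.
  apply: (@riso_inj (rjoin (rjoin point (rjoin point point)) point)
    (RootedGraph (inr i : complete_bipartite 1 3)) (fun y => match y with
    | inr _ => inr (s 0) | inl (inr (inr _)) => inl ord0 | inl (inl _) => inr (s 1)
    | inl (inr (inl _)) => inr (s 2) end)).
  + by move=> [[a|[a|a]]|a] [[b|[b|b]]|b] //;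
    rewrite ?(ord1 a) ?(ord1 b) // => -[] /sI E; have := E isT isT.
  + by rewrite !card_rjoin card_sum !card_ord.
  + by move=> [[a|[a|a]]|a] [[b|[b|b]]|b]; rewrite (ord1 a) (ord1 b).
  + by rewrite /= s0.
- pose s m : 'I_3 := if x == ord0 then inord m else inord (2 - m).
  have xE : x = s 0.
    case: x @s xl xu => [[|[|[|//]]] lt] //= _ xu; apply: val_inj;
      rewrite /= ?inordK //.
    by have := xu (@Ordinal 3 0 isT) (@Ordinal 3 2 isT) isT isT.
  have sE m n : m < 3 -> n < 3 -> adj (s m : Path 3) (s n) = (m.+1 == n) || (n.+1 == m).
    move=> m4 n4; rewrite /= /path_adj /s; case: ifP => _; rewrite !inordK; lia.
  have sI m n : m < 3 -> n < 3 -> s m = s n -> m = n.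
    by move=> m4 n4; rewrite /s; case: ifP => _ /(congr1 val); rewrite /= !inordK; lia.
  apply: (@riso_inj (rjoin (rjoin point point) point)
    (RootedGraph (x : Path 3)) (fun y => match y with
    | inr _ => s 0 | inl (inr _) => s 1 | inl (inl _) => s 2 end)).
  + by move=> [[a|a]|a] [[b|b]|b] /sI E; rewrite ?(ord1 a) ?(ord1 b) //;
    have := E isT isT.
  + by rewrite !card_rjoin !card_ord.
  + by move=> [[a|a]|a] [[b|b]|b]; rewrite (ord1 a) (ord1 b) sE.
  + by [].
- apply: (@riso_inj (rjoin point point) (RootedGraph (x : Path 2)) (fun y =>
  match y with
    | inr _ => x | inl _ => rev_ord x end)).
  + move=> [a|a] [b|b] /(congr1 val) /= E; rewrite ?(ord1 a) ?(ord1 b) //; exfalso;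
    have := ltn_ord x; lia.
  + by rewrite !card_rjoin !card_ord.
  + by move=> [a|a] [b|b]; rewrite (ord1 a) (ord1 b); case: x {xl xu} => [[|[|//]] lt].
  + by [].
Qed.

Lemma piece_has_leaf p : exists x : piece_graph p, is_leaf x.
Proof.
case: p => [[] []] /=.
- exists (@Ordinal 4 0 isT);
  rewrite /is_leaf /degree (_ : [set u | _] = [set @Ordinal 4 1 isT]) ?cards1 //.
  by apply/setP => -[[|[|[|[|//]]]] lt]; rewrite !inE.
- exists (inr (@Ordinal 3 0 isT));
  rewrite /is_leaf /degree (_ : [set u | _] = [set inl ord0]) ?cards1 //.
  by apply/setP => -[a|a]; rewrite !inE // (ord1 a).
- exists (@Ordinal 3 0 isT);
  rewrite /is_leaf /degree (_ : [set u | _] = [set @Ordinal 3 1 isT]) ?cards1 //.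
  by apply/setP => -[[|[|[|//]]] lt]; rewrite !inE.
- exists (@Ordinal 2 0 isT);
  rewrite /is_leaf /degree (_ : [set u | _] = [set @Ordinal 2 1 isT]) ?cards1 //.
  by apply/setP => -[[|[|//]] lt]; rewrite !inE.
Qed.

(** The choice of leaves is immaterial, since [piece_pendant] holds for every leaf. *)
Lemma Gw_plant Ts R ps : Gw Ts R -> Ts = map piece_graph ps ->
  riso R (plant point (of_pieces ps)).
Proof.
move=> gw; elim: gw ps => [|T x {}Ts {}R xl _ IH] [|p ps] //; first by move=> _;
  apply: riso_refl.
case=> TE /IH {}IH; subst T.
by apply: identify_pendant IH; apply: piece_pendant.
Qed.

Lemma plant_Gw ps :
  exists2 R, Gw (map piece_graph ps) R & riso R (plant point (of_pieces ps)).
Proof.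
elim: ps => [|p ps [R gw RE]]; first by exists point; [exact: Gw_nil|apply: riso_refl].
have [x xl] := piece_has_leaf p.
exists (identify (RootedGraph x) R); first exact: Gw_cons.
by apply: identify_pendant RE; apply: piece_pendant.
Qed.

(** * Decomposition of potted graphs *)

Section Induced.
Variables (G : sgraph) (S : {set G}).

Definition within : rel G := fun u v => [&& adj u v, u \in S & v \in S].

Lemma induced_connect u v (uS : u \in S) (vS : v \in S) :
  connect within u v -> connect (@adj (induced S)) (exist _ u uS) (exist _ v vS).
Proof.
case/connectP=> p; elim: p u uS => [|w p IH] u uS /=.
  by move=> _ vE; subst v; rewrite (bool_irrelevance vS uS).
case/andP=> /and3P[uw _ wS] wp vE; apply: connect_trans (IH w wS wp vE).
exact: connect1.
Qed.

Lemma induced_is_cycle (d : seq (induced S)) : is_cycle d -> is_cycle (map val d).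
Proof.
rewrite /is_cycle /ucycleb size_map (map_inj_uniq val_inj) => /and3P[-> dc ->].
by rewrite andbT /=; case: d dc => //= z d; rewrite -map_rcons path_map.
Qed.

Lemma card_induced : #|induced S| = #|S|.
Proof. by rewrite card_sig. Qed.

End Induced.

Lemma connected_closed (G : sgraph) (a : pred G) x : connected G ->
  a x -> (forall u v, adj u v -> a u -> a v) -> forall z, a z.
Proof.
move=> cG ax clo z.
have cl : closed (@adj G) a by apply: intro_closed => //; apply/sym_connect_sym/adj_sym.
by have := closed_connect cl (cG x z); rewrite !unfold_in ax => <-.
Qed.

(** If [x] has a neighbour [y] outside the image of [B], the component [C] of [y]
    in [G - x] is attached to [x] by the edge [xy] alone, since a second edge
    would close a cycle through [y].  So [G] splits along the bridge [xy]. *)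
Lemma decomposition n (B : rooted_graph) (G : sgraph) (f : B -> G) :
  #|G| <= n -> injective f -> (forall u v, adj (f u) (f v) = adj u v) ->
  connected G ->
  (forall u, u != root_vertex B -> forall z, adj (f u) z -> z \in codom f) ->
  (forall d : seq G, is_cycle d -> f (root_vertex B) \in d /\ {subset d <= codom f}) ->
  exists t, riso (RootedGraph (f (root_vertex B))) (plant B t).
Proof.
elim: n B G f => [|n IH] B G f leGn fI fE cG Hd Hc.
  by move: leGn; rewrite leqn0 => /eqP/card0_eq/(_ (f (root_vertex B))).
set x := f (root_vertex B).
have [/existsP[y /andP[xy yf]]|none] :=
  boolP [exists y, adj x y && (y \notin codom f)]; last first.
  have all_f : forall z, z \in codom f.
    apply: (connected_closed cG (codom_f f (root_vertex B))) => u v uv /codomP[b bE].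
    have [broot|broot] := eqVneq b (root_vertex B); last by apply: Hd broot _ _;
      rewrite -bE.
    move: none; rewrite negb_exists => /forallP/(_ v).
    by rewrite /x -broot -bE uv /= negbK.
  exists Leaf; apply: riso_sym; apply: (@riso_inj B (RootedGraph x) f) => //.
  rewrite -(card_codom fI); apply: subset_leq_card; apply/subsetP => z _; exact: all_f.
(* Adjacency in G - x, in which [C] is the component of [y]. *)
pose e' : rel G := fun u v => [&& adj u v, u != x & v != x].
have e'sym : connect_sym e'.
  by apply: sym_connect_sym => u v; rewrite /e' adj_sym [X in _ && X]andbC.
pose C := [set z | connect e' y z].
have yx : y != x by apply: contraNneq yf => ->; apply: codom_f.
have yC : y \in C by rewrite inE.
have Cstep u v : u \in C -> adj u v -> v != x -> u != x -> v \in C.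
  by rewrite !inE => yu uv vx ux; apply: connect_trans yu (connect1 _);
    rewrite /e' uv ux vx.
have Cx z : z \in C -> z != x.
  rewrite inE => /connectP[p + ->]; elim/last_ind: p => // p w _.
  by rewrite rcons_path last_rcons => /and4P[].
have xC : x \notin C by apply/negP => /Cx; rewrite eqxx.
have C_adj z : z \in C -> adj x z -> z = y.
  rewrite inE => /connectP[p0 yp0 ->] xz; apply/eqP/negPn/negP => zy.
  case/shortenP: yp0 xz zy => p yp up _ xz zy.
  have cyc : is_cycle (x :: y :: p).
    rewrite /is_cycle /ucycleb; apply/and3P; split.
    - by case: p zy {yp up xz} => //=; rewrite eqxx.
    - rewrite /= xy /= rcons_path adj_sym xz andbT.
      by apply: sub_path yp => u v /and3P[].
    - rewrite cons_uniq up andbT; apply/negP; rewrite inE eq_sym (negbTE yx) /= => xp.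
      by move: xC; rewrite inE (path_connect yp) // inE xp orbT.
  have [_ /(_ y)] := Hc _ cyc.
  by rewrite !inE eqxx orbT (negbTE yf) => /(_ isT).
(* A walk in G - x that starts in the image of [B] never leaves it, so it cannot reach [y]. *)
have C_codom b : f b \notin C.
  apply/negP; rewrite inE e'sym => /connectP[p].
  elim: p b => [|w p IHp] b /= => [_ yE|/andP[/and3P[bw bx wx] wp] yE].
    by rewrite yE codom_f in yf.
  have /codomP[b' wE] : w \in codom f.
    by apply: Hd bw; apply: contraNneq bx => ->.
  by apply: (IHp b'); rewrite -wE.
pose D := ~: C.
have xD : x \in D by rewrite inE.
have fD b : f b \in D by rewrite inE.
have cC : connected (induced C).
  move=> [u uC] [v vC]; apply: induced_connect.
  have : connect e' u v by move: uC vC; rewrite !inE e'sym => uy /(connect_trans uy).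
  case/connectP=> p up ->; move: up; elim: p u uC {vC} => //= w p IHp u uC.
  case/andP=> /and3P[uw ux wx] wp; have wC := Cstep _ _ uC uw wx ux.
  by apply: connect_trans (IHp _ wC wp); apply: connect1; rewrite /within uw uC.
have xDconn z : z \in D -> connect (within D) x z.
  have : (z \in C) || connect (within D) x z.
    apply: (connected_closed (x := x) (a := fun z =>
      (z \in C) || connect (within D) x z) cG).
      by rewrite /= connect0 orbT.
    move=> u v uv /=; have [//|vC] := boolP (v \in C); rewrite orFb.
    have [uC _|uC /= xu] := boolP (u \in C).
      have [->|vx] := eqVneq v x; first exact: connect0.
      by rewrite (Cstep u v) ?(Cx u) in vC.
    apply: connect_trans xu (connect1 _); by rewrite /within uv !in_setC uC.
  by rewrite in_setC; case: (z \in C).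
have cD : connected (induced D).
  have Dsym : connect_sym (within D).
    by apply: sym_connect_sym => u v; rewrite /within adj_sym [X in _ && X]andbC.
  move=> [u uD] [v vD]; apply: induced_connect.
  by apply: connect_trans (xDconn _ vD); rewrite Dsym; apply: xDconn.
have ltC : #|C| <= n.
  by rewrite -ltnS (leq_trans _ leGn) // -cardsT proper_card // properE subsetT;
    apply/subsetPn; exists x.
have ltD : #|D| <= n.
  rewrite -ltnS (leq_trans _ leGn) // -cardsT proper_card // properE subsetT;
    apply/subsetPn.
  by exists y; rewrite // inE yC.
(* [C] contains no cycle, as every cycle passes through [x]; induction therefore applies with a
   single vertex placed at [y]. *)
have [tC hC] : exists t, riso (@RootedGraph (induced C) (exist _ y yC)) (plant point t).
  apply: (IH point (induced C) (fun _ => exist _ y yC)).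
  - by rewrite card_induced.
  - by move=> u v _; rewrite (ord1 u) (ord1 v).
  - by move=> u v; rewrite (ord1 u) (ord1 v) !adj_irrefl.
  - exact: cC.
  - by move=> u; rewrite (ord1 u).
  - move=> d /induced_is_cycle /Hc [/mapP[[w wC] _ /= xw] _].
    by rewrite -xw (negbTE xC) in wC.
(* [D] contains the whole image of [B], and it is smaller than G because it lacks [y]. *)
have [tD hD] : exists t, riso (@RootedGraph (induced D) (exist _ x xD)) (plant B t).
  have -> : exist _ x xD =
    exist (fun z => z \in D) (f (root_vertex B)) (fD _) by apply: val_inj.
  apply: (IH B (induced D) (fun b => exist _ (f b) (fD b))).
  - by rewrite card_induced.
  - by move=> u v [] /fI.
  - by move=> u v; apply: fE.
  - exact: cD.
  - move=> u ur [z zD] /(Hd u ur) /codomP[b zb].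
    by apply/codomP; exists b; apply: val_inj; exact: zb.
  - move=> d /induced_is_cycle /Hc [/mapP[[w wD] wd /= xw] sub]; split.
      by rewrite (_ : exist _ _ _ = exist (fun z => z \in D) w wD) //; apply: val_inj.
    move=> z zd; have /sub/codomP[b zb] := map_f val zd.
    by apply/codomP; exists b; apply: val_inj.
exists (Graft tC tD); apply: riso_trans (rjoin_riso hC hD); apply: riso_sym.
apply: (@riso_inj (rjoin (@RootedGraph (induced C) (exist _ y yC))
  (@RootedGraph (induced D) (exist _ x xD)))
  (RootedGraph x) (fun z => match z with inl c => val c | inr d => val d end)).
- move=> [[u uC]|[u uD]] [[v vC]|[v vD]] /= E; subst v.
  + by congr inl; apply: val_inj.
  + by exfalso; move: (vD); rewrite in_setC uC.
  + by exfalso; move: (uD); rewrite in_setC vC.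
  + by congr inr; apply: val_inj.
- by rewrite card_rjoin !card_induced cardsC.
- have mixed u v (uC : u \in C) (vD : v \in D) : adj u v = (u == y) && (v == x).
    apply/idP/andP => [uv|[/eqP-> /eqP->]]; last by rewrite adj_sym.
    have vx : v = x by apply: contraTeq vD => vx; rewrite in_setC negbK;
      apply: Cstep uC uv vx (Cx _ uC).
    by rewrite -(C_adj u) ?vx ?eqxx // adj_sym -vx.
  move=> [[u uC]|[u uD]] [[v vC]|[v vD]] //=; first by rewrite mixed.
  by rewrite adj_sym mixed.
- by [].
Qed.

Lemma mem_cycle_edges (G : sgraph) (c d : seq G) :
  cycle_edges c = cycle_edges d -> {subset c <= d}.
Proof.
move=> cd z zc; have : [set z; next c z] \in cycle_edges d.
  by rewrite -cd; apply/imsetP; exists z.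
case/imsetP=> w wd E; have : z \in [set w; next d w] by rewrite -E set21.
by rewrite !inE => /orP[]/eqP->; rewrite ?mem_next.
Qed.

Lemma next_nth_ordS (T : eqType) (x0 : T) (c : seq T) (i : 'I_(size c)) :
  uniq c -> next c (nth x0 c i) = nth x0 c (ordS i).
Proof.
move=> cu; rewrite next_nth mem_nth // index_uniq //.
case: c i cu => [|y p] [i lt] //= cu.
move: lt; rewrite ltnS leq_eqVlt => /orP[/eqP ->|lt].
  by rewrite nth_default // modnn.
by rewrite modn_small //= (set_nth_default x0).
Qed.

Lemma ordS_neq_pred k (i : 'I_k) : 2 < k -> ordS i != ord_pred i.
Proof.
move=> k2; rewrite -val_eqE /=; have := ltn_ord i; move: (nat_of_ord i) => {}i lt.
have -> : i.+1 %% k = if i.+1 == k then 0 else i.+1.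
  by case: eqP => [->|ne]; rewrite ?modnn // modn_small //; lia.
have -> : (i + k).-1 %% k = if i == 0 then k.-1 else i.-1.
  case: eqP => [->|ne]; first by rewrite modn_small //; lia.
  by rewrite (_ : (i + k).-1 = i.-1 + k) ?modnDr ?modn_small //; lia.
by case: (i.+1 =P k) => ?; case: (i =P 0) => ?; apply/eqP; lia.
Qed.

(** The unique cycle is indexed by [Cycle k], and [decomposition] applies to this embedding: cycle
    vertices other than the branching one have degree 2, so they have no neighbours off the
    cycle. *)
Lemma potted_plant n k (G : sgraph) : potted_of G n k ->
  2 < k /\ exists (v : Cycle k) t,
    iso G (plant (RootedGraph v) t) /\ n = k + (tree_order t).-1.
Proof.
case=> -[[cG [c cc edges]] hub] cardG size_c.
have sk := size_c c cc; have /andP[k2 /andP[cyc cu]] := cc; rewrite sk in k2.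
split=> //; subst k; have /eqP/cards1P[x xE] := hub c cc.
have xc : x \in c.
  by have := set11 x; rewrite -xE inE => /andP[].
pose f (i : Cycle (size c)) : G := nth x c i.
have fI : injective f by move=> i j /eqP; rewrite nth_uniq // => /eqP/val_inj.
have f_next i : adj (f i) (f (ordS i)).
  by rewrite /f -next_nth_ordS //; apply: next_cycle cyc _; rewrite mem_nth.
have f_prev i : adj (f i) (f (ord_pred i)).
  by rewrite adj_sym -{2}(ord_predK i).
have succ_pred (i : Cycle (size c)) : ordS i != ord_pred i.
  by apply: ordS_neq_pred.
have nbr u z : f u != x -> adj (f u) z -> z = f (ordS u) \/ z = f (ord_pred u).
  move=> ux uz; have deg2 : degree (f u) <= 2.
    have : f u \notin [set x] by rewrite inE.
    by rewrite -xE inE mem_nth //= -leqNgt.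
  have /eqP E : [set f (ordS u); f (ord_pred u)] == [set w | adj (f u) w].
    rewrite eqEcard cards2 (inj_eq fI) succ_pred deg2 andbT.
    by apply/subsetP => w; rewrite !inE => /orP[]/eqP->.
  have : z \in [set w | adj (f u) w] by rewrite inE.
  by rewrite -E !inE => /orP[]/eqP->; [left|right].
(* The cycle has no chord: one end of any edge between cycle vertices is not [x], and that end has
   only its two cyclic neighbours. *)
have fE u v : adj (f u) (f v) = adj u v.
  apply/idP/idP=> [uv|/andP[_ /orP[]/eqP<-]]; last 2 first.
  - exact: f_next.
  - by rewrite adj_sym.
  have adj_ij (i j : Cycle (size c)) : f i != x -> adj (f i) (f j) -> adj i j.
    move=> ix /(nbr _ _ ix); have ij : i != j -> (ordS i == j) || (ordS j == i) ->
      adj i j.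
      by move=> ? ?; apply/andP.
    case=> /fI jE; apply: ij; rewrite jE ?ord_predK ?eqxx ?orbT // -(inj_eq fI);
      apply/eqP => E.
      by have := f_next i; rewrite -E adj_irrefl.
    by have := f_prev i; rewrite -E adj_irrefl.
  have [ux|ux] := eqVneq (f u) x; last exact: adj_ij.
  rewrite adj_sym; apply: adj_ij; last by rewrite adj_sym.
  by apply/eqP => vx; move: uv; rewrite ux vx adj_irrefl.
have codom_c z : (z \in codom f) = (z \in c).
  apply/codomP/idP=> [[i ->]|zc]; first exact: mem_nth.
  have lt : index z c < size c by rewrite index_mem.
  by exists (Ordinal lt); rewrite /f nth_index.
have /codomP[v vE] : x \in codom f by rewrite codom_c.
have [t GE] : exists t, riso (@RootedGraph G (f v)) (plant (RootedGraph v) t).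
  apply: (@decomposition #|G| (RootedGraph v) G f) => //.
  - move=> u uv z uz; rewrite codom_c.
    have ux : f u != x by rewrite vE (inj_eq fI).
    by case: (nbr _ _ ux uz) => ->; apply: mem_nth.
  - move=> d /edges dE; rewrite -vE; split; first exact: mem_cycle_edges xc.
    by move=> z zd; rewrite codom_c (mem_cycle_edges dE).
exists v, t; split; first exact: riso_iso GE.
by rewrite -cardG (riso_card GE) card_plant card_ord.
Qed.

Lemma pieces_perm (ps : seq piece) :
  perm_eq ps (nseq (nleaf ps) (false, false) ++ nseq (nedge ps) (false, true)
    ++ [seq (true, b) | b <- [seq p.2 | p <- ps & p.1]]).
Proof.
apply/permP => a; rewrite !count_cat !count_nseq /nleaf /nedge.
elim: ps => [|p ps IH]; first by rewrite !muln0.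
case: p => [[] []] /=; rewrite IH ?add0n ?add1n ?mulnS;
move: (count a [seq _ | _ <- _]) (count_mem _ ps) (count_mem _ ps) => u v w;
move: (nat_of_bool (a (true, true))) (nat_of_bool (a (true, false)))
  (nat_of_bool (a (false, true))) (nat_of_bool (a (false, false))) => *; lia.
Qed.

(** * Extremal graphs *)

Lemma positive_state_from b t : positive b -> positive (state_from b t).
Proof.
by elim: t b => //= c IHc t IHt b bp; apply: step_positive; [apply: IHc|apply: IHt].
Qed.

Lemma num_plant k (v : Cycle k) t : 0 < k -> k %% 3 = 0 ->
  num_max_dissociation (plant (RootedGraph v) t) = weight (potted_state t).
Proof.
move=> k0 k3; apply: represents_num; first exact/represents_plant/represents_cycle.
have := @positive_state_from (StC 1 0 2) t isT;
  rewrite -/(potted_state t) potted_stateE /=; lia.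
Qed.

(** [potted_plant] supplies one presentation of [G] as a planted tree, but [num_plant] evaluates
    every presentation; hence the equality case may ask for any extremal one. *)
Lemma num_max_dissociation_bound n k (G : sgraph) : 0 < k -> k + 4 <= n ->
  k %% 3 = 0 -> potted_of G n k ->
  num_max_dissociation G <= max_weight (n - k) /\
  (num_max_dissociation G = max_weight (n - k) <->
   exists (v : Cycle k) t,
     iso G (plant (RootedGraph v) t) /\ extremal ((n - k) %% 3) t).
Proof.
move=> k0 le_nk k3 /[dup] [[_ cardG _]] /potted_plant[_ [v [t [GE nE]]]].
have numE (w : Cycle k) s : iso G (plant (RootedGraph w) s) ->
    num_max_dissociation G = weight (potted_state s).
  by move/num_max_dissociation_iso->; apply: num_plant.
have orderE (w : Cycle k) s : iso G (plant (RootedGraph w) s) ->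
  n - k = (tree_order s).-1.
  by move/iso_card; rewrite cardG card_plant card_ord; lia.
have eq_ext (w : Cycle k) s : iso G (plant (RootedGraph w) s) ->
  extremal ((n - k) %% 3) s ->
    num_max_dissociation G = max_weight (n - k).
  by move=> /[dup] /numE-> /orderE-> /extremal_weight.
have t4 : 4 < tree_order t by lia.
have NE : n - k = (tree_order t).-1 by lia.
split.
  case: (weight_lt_or_extremal t4) => [|ext];
    first by rewrite (numE _ _ GE) NE => /ltnW.
  by rewrite (eq_ext _ _ GE) // NE.
split=> [eqG|[w [s [Gs]]]]; last exact: eq_ext Gs.
exists v, t; split; rewrite // NE; case: (weight_lt_or_extremal t4) => //.
by rewrite -(numE _ _ GE) -NE eqG ltnn.
Qed.

(** * The families as planted trees *)

Definition branch_seq (ps : seq piece) : seq bool := [seq p.2 | p <- ps & p.1].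

Lemma size_branch_seq ps : size (branch_seq ps) = nbranch ps.
Proof. by rewrite size_map size_filter. Qed.

Lemma nend_branch_seq ps : nend ps = count id (branch_seq ps).
Proof. by rewrite /nend count_map count_filter; apply: eq_count => -[[] []]. Qed.

Definition pieces i j bs : seq piece :=
  nseq i (false, false) ++ nseq j (false, true) ++ [seq (true, b) | b <- bs].

(** [Q] carries what distinguishes the families beyond [i] and [j]: only copies of P_4 in the first,
    at least one branch in the sixth and seventh. *)
Definition glued (Q : pred (seq bool)) i j (R : rooted_graph) : Prop :=
  exists2 bs, Q bs & Gw (map piece_graph (pieces i j bs)) R.

Lemma branchesE bs : branches bs = map piece_graph [seq (true, b) | b <- bs].
Proof. by rewrite -map_comp; apply: eq_map => -[]. Qed.

Lemma nleaf_pieces i j bs : nleaf (pieces i j bs) = i.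
Proof.
by rewrite /nleaf !count_cat !count_nseq count_map (eq_count (a2 := pred0)) //
  count_pred0 /= mul1n mul0n !addn0.
Qed.

Lemma nedge_pieces i j bs : nedge (pieces i j bs) = j.
Proof.
by rewrite /nedge !count_cat !count_nseq count_map (eq_count (a2 := pred0)) //
  count_pred0 /= mul1n mul0n !addn0.
Qed.

Lemma branch_seq_pieces i j bs : branch_seq (pieces i j bs) = bs.
Proof.
rewrite /branch_seq /pieces; elim: i => [|i IH] //=; elim: j => [|j IH] //=.
by elim: bs => //= b bs ->.
Qed.

Lemma glued_plant Q i j R : glued Q i j R ->
  exists2 ps, riso R (plant point (of_pieces ps))
    & [/\ nleaf ps = i, nedge ps = j & Q (branch_seq ps)].
Proof.
move=> [bs Qbs gw]; exists (pieces i j bs); first exact: Gw_plant gw (erefl _).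
by rewrite nleaf_pieces nedge_pieces branch_seq_pieces.
Qed.

Lemma plant_glued (Q : pred (seq bool)) ps : Q (branch_seq ps) ->
  exists2 R, glued Q (nleaf ps) (nedge ps) R & riso R (plant point (of_pieces ps)).
Proof.
move=> Qps; have [R gw RE] := plant_Gw (pieces (nleaf ps) (nedge ps) (branch_seq ps)).
exists R; first by exists (branch_seq ps).
by apply: riso_trans RE _; apply: plant_perm; rewrite perm_sym; apply: pieces_perm.
Qed.

(** An edge from the cycle to [w] makes the whole tree a single component, hence the outer
    [Graft]. *)
Lemma cycle_plusP k (Ts : rooted_graph -> Prop) Q i j G :
  (forall R, Ts R <-> glued Q i j R) ->
  cycle_plus k Ts G <-> exists (v : Cycle k) ps,
    iso G (plant (RootedGraph v) (Graft (of_pieces ps) Leaf)) /\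
    [/\ nleaf ps = i, nedge ps = j & Q (branch_seq ps)].
Proof.
have rE (v : Cycle k) R ps : riso R (plant point (of_pieces ps)) ->
    iso (join_by_edge (RootedGraph v) R)
      (plant (RootedGraph v) (Graft (of_pieces ps) Leaf)).
  move=> RE; apply: iso_trans (join_by_edgeC _ _) _; apply: riso_iso.
  by apply: rjoin_riso RE (riso_refl _).
move=> TsE; split=> [[v [R [/TsE/glued_plant[ps RE cnt] GE]]]|
  [v [ps [GE [i_ps j_ps Qps]]]]].
  by exists v, ps; split=> //; apply: iso_trans GE (rE _ _ _ RE).
have [R TR RE] := plant_glued Qps; exists v, R.
split; first by apply/TsE; rewrite -i_ps -j_ps.
by apply: iso_trans GE _; apply: iso_sym; apply: rE.
Qed.

(** With [w] on the cycle, each branch is a component of its own. *)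
Lemma cycle_dotP k (Ts : rooted_graph -> Prop) Q i j G :
  (forall R, Ts R <-> glued Q i j R) ->
  cycle_dot k Ts G <-> exists (v : Cycle k) ps,
    iso G (plant (RootedGraph v) (of_pieces ps)) /\
    [/\ nleaf ps = i, nedge ps = j & Q (branch_seq ps)].
Proof.
have rE (v : Cycle k) R ps : riso R (plant point (of_pieces ps)) ->
    iso (identify (RootedGraph v) R) (plant (RootedGraph v) (of_pieces ps)).
  move=> RE; apply: riso_iso; apply: riso_trans (identify_plant _ _).
  exact: identify_riso.
move=> TsE; split=> [[v [R [/TsE/glued_plant[ps RE cnt] GE]]]|
  [v [ps [GE [i_ps j_ps Qps]]]]].
  by exists v, ps; split=> //; apply: iso_trans GE (rE _ _ _ RE).
have [R TR RE] := plant_glued Qps; exists v, R.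
split; first by apply/TsE; rewrite -i_ps -j_ps.
by apply: iso_trans GE _; apply: iso_sym; apply: rE.
Qed.

Lemma trees1_glued R : trees1 R <-> glued (all id) 0 1 R.
Proof.
have nsE l : Path 3 :: nseq l (Path 4) = map piece_graph (pieces 0 1 (nseq l true)).
  by rewrite /pieces /= !map_nseq.
split=> [[l]|[bs bsT]]; first by rewrite nsE; exists (nseq l true);
  rewrite ?all_nseq ?orbT.
have -> : bs = nseq (size bs) true by apply/all_pred1P; apply: sub_all bsT => -[].
by rewrite -nsE; exists (size bs).
Qed.

Lemma glued_branches (Q : pred (seq bool)) i j pre R :
  pre = map piece_graph (nseq i (false, false) ++ nseq j (false, true)) ->
  (exists2 bs, Q bs & Gw (pre ++ branches bs) R) <-> glued Q i j R.
Proof. by move=> ->; split=> -[bs Qbs gw]; exists bs => //; move: gw;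
  rewrite /pieces branchesE -map_cat -catA. Qed.

Lemma glued_branchesT i j pre R :
  pre = map piece_graph (nseq i (false, false) ++ nseq j (false, true)) ->
  (exists bs, Gw (pre ++ branches bs) R) <-> glued xpredT i j R.
Proof.
move=> /glued_branches <-; split=> [[bs gw]|[bs _ gw]]; by exists bs.
Qed.

Theorem theorem1p1 (n k : nat) (n_gt0 : 0 < n) (k_gt0 : 0 < k)
    (le_nk : k + 4 <= n) (k_mod3 : k = 0 %[mod 3])
    (G : sgraph) (GP : potted_of G n k) :
  [/\ n = 0 %[mod 3] ->
        num_max_dissociation G <= 3 ^ ((n - k) %/ 3) + (n - k) %/ 3 + 1 /\
        (num_max_dissociation G = 3 ^ ((n - k) %/ 3) + (n - k) %/ 3 + 1 <->
         family1 k G),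
      n = 1 %[mod 3] ->
        num_max_dissociation G <= 3 ^ ((n - k - 1) %/ 3) + 1 /\
        (num_max_dissociation G = 3 ^ ((n - k - 1) %/ 3) + 1 <->
         family2 k G)
    & n = 2 %[mod 3] ->
        num_max_dissociation G <= 3 ^ ((n - k - 2) %/ 3) /\
        (num_max_dissociation G = 3 ^ ((n - k - 2) %/ 3) <->
         [\/ family3 k G, family4 k G, family5 k G
           | family6 k G \/ family7 k G])].
Proof.
have k3 : k %% 3 = 0 by rewrite k_mod3.
have H := num_max_dissociation_bound k_gt0 le_nk k3 GP; rewrite /max_weight in H.
split=> nr.
- have rE : (n - k) %% 3 = 0 by lia.
  rewrite rE in H *; case: H => le eqE; split=> //;
    rewrite eqE /family1 (cycle_plusP k G trees1_glued).
  split=> [[v [t [Gt [ps tE [i0 j1 el]]]]]|[v [ps [Gt [i0 j1 Qps]]]]].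
    exists v, ps; rewrite -tE; split=> //; split=> //.
    by rewrite all_count -nend_branch_seq size_branch_seq; apply/eqP.
  exists v, (Graft (of_pieces ps) Leaf); split=> //; exists ps => //; split=> //.
  by rewrite nend_branch_seq -size_branch_seq; apply/eqP; rewrite -all_count.
- have rE : (n - k) %% 3 = 1 by lia.
  have -> : (n - k - 1) %/ 3 = (n - k) %/ 3 by lia.
  rewrite rE in H *; case: H => le eqE; split=> //; rewrite eqE /family2.
  rewrite (cycle_plusP k G (fun R => glued_branchesT (i := 1) (j := 1) R erefl)).
  split=> [[v [t [Gt [ps tE [i1 j1]]]]]|[v [ps [Gt [i1 j1 _]]]]].
    by exists v, ps; rewrite -tE.
  by exists v, (Graft (of_pieces ps) Leaf); split=> //; exists ps.
have rE : (n - k) %% 3 = 2 by lia.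
have -> : (n - k - 2) %/ 3 = (n - k) %/ 3 by lia.
rewrite rE in H *; case: H => le eqE; split=> //; rewrite eqE.
have f3 := cycle_plusP k G (fun R => glued_branchesT (i := 0) (j := 2) R erefl).
have f4 := cycle_plusP k G (fun R => glued_branchesT (i := 2) (j := 1) R erefl).
have f5 := cycle_plusP k G (fun R => glued_branchesT (i := 4) (j := 0) R erefl).
have f6 := cycle_dotP k G (fun R => glued_branches (fun bs =>
  0 < size bs) (i := 0) (j := 1) R erefl).
have f7 := cycle_dotP k G (fun R => glued_branches (fun bs =>
  0 < size bs) (i := 2) (j := 0) R erefl).
split=> [[v [t [Gt [[ps tE]|[ps tE]]]]]|].
- rewrite !inE !xpair_eqE => /or3P[] /andP[/eqP i_ps /eqP j_ps]; rewrite tE in Gt.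
  + by constructor 1; apply/f3; exists v, ps.
  + by constructor 2; apply/f4; exists v, ps.
  + by constructor 3; apply/f5; exists v, ps.
- rewrite !inE !xpair_eqE => ij; rewrite tE in Gt.
  (* Without branches there would be only two vertices off the cycle, against n - k being at least
     4. *)
  have big : 0 < size (branch_seq ps).
    rewrite size_branch_seq; move/iso_card: Gt; case: GP => _ -> _.
    by rewrite card_plant card_ord tree_order_of_pieces; lia.
  case/orP: ij => /andP[/eqP i_ps /eqP j_ps].
  + by constructor 4; left; apply/f6; exists v, ps.
  + by constructor 4; right; apply/f7; exists v, ps.
case=> [/f3|/f4|/f5|[/f6|/f7]] [v [ps [Gt [i_ps j_ps _]]]]; exists v.
- by exists (Graft (of_pieces ps) Leaf); split=> //; left; exists ps;
  rewrite ?i_ps ?j_ps.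
- by exists (Graft (of_pieces ps) Leaf); split=> //; left; exists ps;
  rewrite ?i_ps ?j_ps.
- by exists (Graft (of_pieces ps) Leaf); split=> //; left; exists ps;
  rewrite ?i_ps ?j_ps.
- by exists (of_pieces ps); split=> //; right; exists ps; rewrite ?i_ps ?j_ps.
- by exists (of_pieces ps); split=> //; right; exists ps; rewrite ?i_ps ?j_ps.
Qed.
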